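(* For every positive integer $r$ there exists a constant $c_r>0$, depending only on $r$, such that the following holds. Let $p$ be a prime, let $\mathcal{A},\mathcal{B}\subseteq \mathbb{F}_p^*$ be non-empty sets, and let $\mathcal{H}\subseteq\mathbb{F}_p$ be a Hilbert cube with $$\mathcal{H}\cap(\mathcal{A}\cdot\mathcal{B})=\emptyset\qquad\text{or}\qquad \mathcal{H}\cap(\mathcal{A}+\mathcal{B})^{-1}=\emptyset.$$ Then $$\#\mathcal{H}\le c_r\,\frac{p^{2r+1/2+1/(2r)}}{(\#\mathcal{A}\,\#\mathcal{B})^r}.$$
   Context: $\mathbb{F}_p$ is the finite field with $p$ elements, $\mathbb{F}_p^*=\mathbb{F}_p\setminus\{0\}$, and $\#S$ denotes the cardinality of a finite set $S$. A Hilbert cube (of dimension $d$, where $d\ge 0$ is an integer) in $\mathbb{F}_p$ is a set of the form $$\left\{a_0+\sum_{i=1}^d\varepsilon_i a_i:\ \varepsilon_i\in\{0,1\}\right\}$$ for some elements $a_0,a_1,\ldots,a_d\in\mathbb{F}_p$ (not necessarily distinct or non-zero). The dimension $d$ is arbitrary, and the cardinality is that of the resulting set (elements are not counted with multiplicity). For $\mathcal{A},\mathcal{B}\subseteq\mathbb{F}_p$, $$\mathcal{A}\cdot\mathcal{B}=\{ab:\ a\in\mathcal{A},\ b\in\mathcal{B}\},\qquad (\mathcal{A}+\mathcal{B})^{-1}=\{(a+b)^{-1}:\ a\in\mathcal{A},\ b\in\mathcal{B},\ a\neq -b\}.$$ *)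

(* Defs.v *)
From mathcomp Require Import all_boot all_order all_algebra.

Set Implicit Arguments.
Unset Strict Implicit.
Unset Printing Implicit Defensive.

Import GRing.Theory.
Local Open Scope ring_scope.

(* The coercion of the bool eps i to nat makes [a i *+ eps i] the term
   eps_i a_i.  The dimension d may be 0, and the generators a i may repeat
   or vanish. *)
Definition hilbert_cube (V : finZmodType) (d : nat) (a0 : V) (a : 'I_d -> V) :
    {set V} :=
  [set a0 + \sum_(i < d) a i *+ eps i | eps : {ffun 'I_d -> bool}].

Definition is_hilbert_cube (V : finZmodType) (H : {set V}) : Prop :=
  exists (d : nat) (a0 : V) (a : 'I_d -> V), H = hilbert_cube a0 a.

Definition prod_set (F : finFieldType) (A B : {set F}) : {set F} :=
  [set a * b | a in A, b in B].

Definition inv_sum_set (F : finFieldType) (A B : {set F}) : {set F} :=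
  [set (a + b)^-1 | a in A, b in B & a != - b].

(* Main.v *)
Require Import Defs.
From HB Require Import structures.
From mathcomp Require Import all_boot all_order all_algebra cyclic all_field.
From mathcomp Require Import reals exp.
From mathcomp Require Import ring zify.

Set Implicit Arguments.
Unset Strict Implicit.
Unset Printing Implicit Defensive.

Import Order.TTheory GRing.Theory Num.Theory.
Local Open Scope ring_scope.

(** Split the cube as H = U + V with |V|^(2r) between p and 4^r p.  Fourier
    analysis on the multiplicative group (for A.B), respectively on the additive
    group after inverting u + v (for (A+B)^-1), bounds |U||V|(|A||B|)^(1/2) by p
    times a nontrivial sum of theta(u + v), where theta(x) is chi(x),
    respectively psi(1/x).  Hoelder's inequality reduces this to the moment
    sum_x |sum_v theta(x + v)|^(2r), and after expanding it to the Weil bound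
    O(sqrt p) for sum_x theta(x) prod_w theta(x + w), w <> 0.

    The Weil bound is proved from scratch.  The sum is the first coefficient of
    the L-function of a completely multiplicative function on monic polynomials
    over F_p.  This L-function is a polynomial, and by Newton's identities minus
    the n-th power sum of its inverse roots is the same sum taken over the field
    with p^n elements.  Over the field with Q^2 elements, Q = p^a, Stepanov's
    method (in Bombieri's form, which needs no derivatives) shows that the
    character argument is equidistributed with error O(Q); hence the inverse
    roots have modulus at most sqrt p. *)

(** * Power sums and L-functions *)

(** The window for |V| comes from the moment: tuples without a value attained exactly once
    contribute at most r^(2r) |V|^r p, the others O(|V|^(2r) sqrt p), and the second order of
    magnitude dominates once |V|^(2r) >= p. One generator at most doubles a cube, so the window can
    be hit; its upper end costs the factor p^(1/(2r)) in |H| <= |U||V|, while the bound on |U|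
    accounts for p^(2r+1/2). In the Weil sums one factor is theta(x) and all other shifts are
    nonzero. The simple zero or pole at 0 is used twice: to make the high coefficients of the
    L-function vanish, and to make Stepanov's auxiliary polynomial nonzero. The other shifts may
    then repeat freely, whatever the order of the character. Stepanov's method bounds fibers only
    from above; this suffices because the fibers have a known total size and a nontrivial character
    sums to 0. Fields with Q^2 elements see only even power sums, which control the squares of the
    inverse roots. The final constant is c_r = 2 * 4^r * (r^(2r) + 4r + 2). *)

Definition psum (C : comNzRingType) (s : seq C) (n : nat) : C :=
  \sum_(a <- s) a ^+ n.

(** The geometric series inverts [1 - a *: 'X]; on coefficients no power series are needed. *)
Lemma coef_prod_1subX_recr (C : comNzRingType) (a : C) (p : {poly C}) n :
  p`_n = \sum_(k < n.+1) a ^+ k * ((1 - a *: 'X) * p)`_(n - k).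
Proof.
elim: n => [|n IHn].
  rewrite big_ord_recl big_ord0 /= expr0 mul1r addr0 mulrBl mul1r coefB.
  by rewrite -scalerAl coefZ coefXM mulr0 subr0.
rewrite big_ord_recl expr0 mul1r subn0.
have -> : \sum_(i < n.+1) a ^+ bump 0 i * ((1 - a *: 'X) * p)`_(n.+1 - bump 0 i)
          = a * p`_n.
  by rewrite IHn mulr_sumr; apply: eq_bigr => i _; rewrite exprS mulrA.
by rewrite mulrBl mul1r coefB -scalerAl coefZ coefXM /= addrNK.
Qed.

(** Logarithmic derivative: 'X times the derivative of [L] is minus the sum of [a *: 'X] times the
    product over the other entries, and that product is [L] divided by [1 - a *: 'X]. *)
Lemma newton_identity (C : comNzRingType) (s : seq C) n :
  let L := \prod_(a <- s) (1 - a *: 'X) in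
  \sum_(k < n) psum s k.+1 * L`_(n - k.+1) = - (L`_n *+ n).
Proof.
move=> L.
have dL : 'X * L^`() = - \sum_(a <- s) (a *: 'X) * \prod_(b <- rem a s) (1 - b *: 'X).
  rewrite {}/L; elim: s => [|a s IHs]; first by rewrite !big_nil -polyC1 derivC mulr0 oppr0.
  rewrite !big_cons derivM mulrDr /= eqxx [X in _ + X]mulrCA IHs.
  rewrite derivB -polyC1 derivC derivZ derivX opprD; congr (_ + _).
    by rewrite sub0r alg_polyC mulNr mulrN -mul_polyC mulrA [_ * 'X]mulrC.
  rewrite mulrN; congr (- _); rewrite mulr_sumr big_seq [RHS]big_seq.
  apply: eq_bigr => b bs; case: eqP => [->|_].
    by rewrite mulrCA; congr (_ * _); rewrite [RHS](big_rem b).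
  by rewrite big_cons mulrCA.
have -> : - (L`_n *+ n) = - ('X * L^`())`_n.
  by rewrite coefXM; case: n => [|n]; rewrite ?mulr0n //= coef_deriv.
rewrite dL coefN opprK coef_sum.
under eq_bigr do rewrite /psum mulr_suml.
rewrite exchange_big /= big_seq [RHS]big_seq; apply: eq_bigr => a as_.
rewrite -scalerAl coefZ coefXM; case: n => [|n] /=; first by rewrite big_ord0 mulr0.
rewrite (coef_prod_1subX_recr a) mulr_sumr; apply: eq_bigr => i _.
by rewrite exprS -mulrA subSS /L [in LHS](big_rem a).
Qed.

(** Since [c 0 = 1], the recurrence determines [S] from [c]. By Newton's identities, minus the power
    sums of the inverse roots of the polynomial with coefficients [c] solve the same recurrence. *)
Lemma recurrence_psum (C : closedFieldType) (D : nat) (c S : nat -> C) :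
    c 0 = 1 -> (forall n, (D <= n)%N -> c n = 0) ->
    (forall n, \sum_(k < n) S k.+1 * c (n - k.+1)%N = c n *+ n) ->
  exists2 s : seq C, (size s < D)%N & forall n, S n.+1 = - psum s n.+1.
Proof.
move=> c0 cD rec; pose L := \poly_(j < D) c j.
have D_gt0 : (0 < D)%N.
  by case: D cD @L => // cD _; have := oner_neq0 C; rewrite -c0 cD ?eqxx.
have Lc n : L`_n = c n by rewrite coef_poly; case: ltnP => // /cD ->.
have [z Lz] := closed_field_poly_normal L.
have L0 : L.[0] = 1 by rewrite horner_coef0 Lc.
have Ln0 : L != 0.
  by apply/eqP => L_0; move: L0 (oner_neq0 C); rewrite L_0 horner0 => <-; rewrite eqxx.
have zn0 b : b \in z -> b != 0.
  move=> bz; apply/eqP => b0; have: root L 0.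
    by rewrite Lz rootZ ?lead_coef_eq0 // root_prod_XsubC -b0.
  by rewrite rootE L0 (negPf (oner_neq0 _)).
exists [seq b^-1 | b <- z].
  rewrite size_map -ltnS; have -> : (size z).+1 = size L.
    by rewrite [in RHS]Lz size_scale ?lead_coef_eq0 // size_prod_XsubC.
  by rewrite ltnS (leq_trans (size_poly _ _)).
have LE : L = \prod_(a <- [seq b^-1 | b <- z]) (1 - a *: 'X).
  rewrite big_map; set P := RHS; have [u Lu] : exists u, L = u *: P.
    exists (lead_coef L * \prod_(b <- z) - b).
    rewrite [LHS]Lz -scalerA /P -scaler_prod; congr (_ *: _).
    rewrite big_seq [RHS]big_seq; apply: eq_bigr => b /zn0 bn0.
    by rewrite scalerBr scalerA mulNr divff // scaleN1r opprK addrC scaleNr alg_polyC.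
  have P0 : P.[0] = 1.
    by rewrite /P horner_prod big1 // => a _; rewrite !hornerE subr0.
  by move: L0; rewrite Lu hornerZ P0 mulr1 => ->; rewrite scale1r.
set s := [seq b^-1 | b <- z].
move=> n; have [m] := ubnP n; elim: m n => // m IHm n /ltnSE-le_nm.
have := rec n.+1; have /= := newton_identity s n.+1; rewrite -LE Lc.
rewrite !big_ord_recr /= subnn Lc c0 !mulr1 => nw rc; move: nw.
rewrite -rc opprD => nw.
have eqs : \sum_(i < n) psum s i.+1 * L`_(n.+1 - i.+1) =
          - \sum_(i < n) S i.+1 * c (n.+1 - i.+1)%N.
  rewrite -sumrN; apply: eq_bigr => i _.
  by rewrite Lc IHm ?(leq_trans (ltn_ord i)) // mulNr opprK.
by move: nw; rewrite eqs => /addrI ->; rewrite opprK.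
Qed.

(** Bernoulli's inequality makes the powers of any [t > 1] unbounded. *)
Lemma bounded_powers_le1 (t K : algC) n0 :
  0 <= t -> (forall n, (n0 <= n)%N -> t ^+ n <= K) -> t <= 1.
Proof.
move=> t0 tK; rewrite real_leNgt ?ger0_real //; apply/negP => t1.
have d0 : 0 < t - 1 by rewrite subr_gt0.
have bern n : 1 + n%:R * (t - 1) <= t ^+ n.
  elim: n => [|n IHn]; first by rewrite mul0r addr0.
  have -> : t ^+ n.+1 = t ^+ n + (t - 1) * t ^+ n by rewrite mulrBl mul1r addrC subrK exprS.
  by rewrite -natr1 mulrDl mul1r addrA lerD // ler_peMr ?exprn_ege1 // ltW.
have K0 : 0 <= K by apply: le_trans (tK n0 (leqnn _)); rewrite exprn_ge0.
pose N := Num.bound (K / (t - 1)).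
have KN : K < N%:R * (t - 1).
  rewrite -ltr_pdivrMr //; apply: le_lt_trans (archi_boundP _); rewrite ?lexx //.
  by rewrite divr_ge0 // ltW.
have := tK (maxn n0 N) (leq_maxl _ _); apply/negP; rewrite -real_ltNge ?ger0_real ?exprn_ge0 //.
apply: lt_le_trans KN _; apply: le_trans (bern _).
rewrite -[leLHS]add0r lerD // ler_wpM2r ?ler_nat ?leq_maxr //; exact: ltW.
Qed.

(* Applying the polynomial killing every other element of s to the sequence
   of power sums isolates the contribution of a. *)
Lemma psum_growth (s : seq algC) (B K : algC) n0 : 0 < B ->
  (forall n, (n0 <= n)%N -> `|psum s n| <= K * B ^+ n) ->
  forall a, a \in s -> `|a| <= B.
Proof.
move=> B0 sB a as_.
pose q := \prod_(b <- undup s | b != a) ('X - b%:P).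
have qs n : \sum_(j < size q) q`_j * psum s (n + j) =
            a ^+ n * q.[a] * (count_mem a s)%:R.
  under eq_bigr do rewrite /psum mulr_sumr.
  rewrite exchange_big /=.
  have -> : \sum_(b <- s) \sum_(j < size q) q`_j * b ^+ (n + j) =
            \sum_(b <- s) b ^+ n * q.[b].
    apply: eq_bigr => b _; rewrite horner_coef mulr_sumr.
    by apply: eq_bigr => j _; rewrite exprD mulrCA.
  rewrite (bigID (pred1 a)) /= addrC big1_seq ?add0r; last first.
    move=> b /andP[ba bs]; suff /eqP -> : q.[b] == 0 by rewrite mulr0.
    rewrite /q horner_prod -big_filter (big_rem b) /=; last first.
      by rewrite mem_filter ba mem_undup.
    by rewrite !hornerE subrr mul0r.
  rewrite (eq_bigr (fun=> a ^+ n * q.[a])); last by move=> b /eqP ->.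
  by rewrite big_const_seq iter_addr_0 [RHS]mulr_natr.
have qa : q.[a] != 0.
  rewrite /q horner_prod prodf_seq_neq0; apply/allP => b _; apply/implyP => ba.
  by rewrite !hornerE subr_eq0 eq_sym.
pose k := `|q.[a]| * (count_mem a s)%:R.
have k0 : 0 < k by rewrite mulr_gt0 ?normr_gt0 // ltr0n -has_count has_pred1.
pose K' := \sum_(j < size q) `|q`_j| * (K * B ^+ j).
have aK n : (n0 <= n)%N -> `|a| ^+ n * k <= K' * B ^+ n.
  move=> n0n; rewrite mulrA -[_%:R]normr_nat -normrX -!normrM -qs.
  apply: le_trans (ler_norm_sum _ _ _) _; rewrite mulr_suml; apply: ler_sum => j _.
  rewrite normrM -mulrA ler_wpM2l // -mulrA -exprD [X in B ^+ X]addnC sB //.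
  by rewrite (leq_trans n0n) // leq_addr.
suff : `|a| / B <= 1 by rewrite ler_pdivrMr // mul1r.
apply: (@bounded_powers_le1 _ (K' / k) n0); first by rewrite divr_ge0 // ltW.
move=> n /aK; rewrite expr_div_n ler_pdivrMr ?exprn_gt0 // mulrAC ler_pdivlMr //.
Qed.

(** The even power sums are those of the squared inverse roots, so their growth gives |a|^2 <= [B]
    for each inverse root. The constants [K] and [n0] disappear in the limit, which is how a crude
    error term becomes a sharp bound. *)
Lemma L_function_bound (D : nat) (c S : nat -> algC) (B : nat) (K : algC) n0 :
    (0 < B)%N -> c 0 = 1 -> (forall n, (D <= n)%N -> c n = 0) ->
    (forall n, \sum_(k < n) S k.+1 * c (n - k.+1)%N = c n *+ n) ->
    (forall n, (n0 <= n)%N -> `|S n.*2| <= K * B%:R ^+ n) ->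
  `|S 1| <= D%:R * sqrtC B%:R.
Proof.
move=> B0 c0 cD rec SK; have [s sD Ss] := recurrence_psum c0 cD rec.
have B0' : (0 : algC) < B%:R by rewrite ltr0n.
have ge0B : (0 : algC) <= B%:R by rewrite ltW.
have sB a : a \in s -> `|a| <= sqrtC B%:R.
  move=> as_; rewrite -(@ler_pXn2r _ 2) ?nnegrE ?sqrtC_ge0 // sqrtCK -normrX.
  have := @psum_growth [seq a ^+ 2 | a <- s] B%:R K (maxn n0 1) B0'.
  apply; last by apply/mapP; exists a.
  move=> n; rewrite geq_max => /andP[n0n n_gt0]; have := SK n n0n.
  rewrite -(prednK n_gt0) doubleS Ss normrN -doubleS; congr (`|_| <= _).
  by rewrite /psum big_map; apply: eq_bigr => b _; rewrite -exprM mul2n.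
rewrite Ss normrN /psum; under eq_bigr do rewrite expr1.
apply: le_trans (ler_norm_sum _ _ _) _.
apply: (@le_trans _ _ (\sum_(a <- s) sqrtC B%:R)).
  by rewrite big_seq [leRHS]big_seq; apply: ler_sum.
rewrite big_const_seq count_predT iter_addr_0 -[leLHS]mulr_natl.
by rewrite ler_wpM2r ?sqrtC_ge0 // ler_nat ltnW.
Qed.

(** * The Euler product over a finite field *)

(** Indexing by the lower coefficients turns the monic polynomials of degree [n] into a finite type,
    over which sums can be taken and translated. *)
Definition monic_of_row (R : nzRingType) n (v : 'rV[R]_n) : {poly R} := 'X^n + rVpoly v.

Lemma size_rVpoly (R : nzRingType) n (v : 'rV[R]_n) : (size (rVpoly v) <= n)%N.
Proof. exact: size_poly. Qed.

Lemma size_monic_of_row (R : nzRingType) n (v : 'rV[R]_n) : size (monic_of_row v) = n.+1.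
Proof. by rewrite size_polyDl size_polyXn // ltnS size_rVpoly. Qed.

Lemma monic_of_row_monic (R : nzRingType) n (v : 'rV[R]_n) : monic_of_row v \is monic.
Proof.
rewrite monicE /lead_coef size_monic_of_row coefD coefXn eqxx nth_default ?addr0 //.
exact: size_rVpoly.
Qed.

Lemma monic_of_rowK (R : nzRingType) n : cancel (@monic_of_row R n) poly_rV.
Proof.
move=> v; rewrite -[RHS]rVpolyK; apply/rowP=> i; rewrite !mxE coefD coefXn.
by rewrite ltn_eqF // add0r.
Qed.

Lemma poly_rV_monicK (R : nzRingType) n (P : {poly R}) :
  P \is monic -> size P = n.+1 -> monic_of_row (poly_rV P : 'rV_n) = P.
Proof.
move=> Pm Ps; apply/polyP => i; rewrite coefD coefXn coef_rVpoly.
case: insubP => [j ji <-|]; first by rewrite mxE /= ltn_eqF ?add0r // ltn_ord.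
rewrite -leqNgt addr0 leq_eqVlt => /predU1P[<-|ni].
  by move: Pm; rewrite monicE /lead_coef Ps => /eqP /= ->; rewrite eqxx.
by rewrite gtn_eqF // nth_default ?Ps.
Qed.

Lemma sum_monic_dvd (F : finFieldType) (C : nmodType) (f : {poly F} -> C) n d
    (P : {poly F}) : P \is monic -> size P = d.+1 ->
  \sum_(v : 'rV[F]_n | P %| monic_of_row v) f (monic_of_row v) =
  if (d <= n)%N then \sum_(u : 'rV[F]_(n - d)) f (P * monic_of_row u) else 0.
Proof.
move=> Pm Ps; have P0 := monic_neq0 Pm; case: leqP => [dn|nd]; last first.
  rewrite big1 // => v /(dvdp_leq (monic_neq0 (monic_of_row_monic v))).
  by rewrite Ps size_monic_of_row ltnS leqNgt nd.
have sPu (u : 'rV[F]_(n - d)) : size (P * monic_of_row u) = n.+1.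
  by rewrite size_monicM ?monic_neq0 ?monic_of_row_monic // Ps size_monic_of_row; lia.
have Pum (u : 'rV[F]_(n - d)) : P * monic_of_row u \is monic by rewrite monicMl ?monic_of_row_monic.
rewrite (reindex (fun u : 'rV[F]_(n - d) => poly_rV (P * monic_of_row u) : 'rV_n)) /=.
  apply: eq_big => u; first by rewrite poly_rV_monicK ?dvdp_mulr.
  by rewrite poly_rV_monicK.
exists (fun v => poly_rV (monic_of_row v %/ P)) => [u _|v].
  by rewrite poly_rV_monicK // mulrC mulpK // monic_of_rowK.
rewrite inE => Pv.
have em : monic_of_row v %/ P \is monic.
  by have := monic_of_row_monic v; rewrite -{1}(divpK Pv) monicMr.
have es : size (monic_of_row v %/ P) = (n - d).+1.
  by rewrite size_divp // size_monic_of_row Ps; lia.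
by rewrite poly_rV_monicK // mulrC divpK // monic_of_rowK.
Qed.

Lemma irreducible_factor (F : finFieldType) (P : {poly F}) : (1 < size P)%N ->
  exists Q : {poly F}, [/\ Q \is monic, irreducible_poly Q & Q %| P].
Proof.
have [m] := ubnP (size P); elim: m P => // m IHm P /ltnSE-Pm P1.
have [/irreducibleP Pi|] := boolP (irreducibleb P).
  exists ((lead_coef P)^-1 *: P).
  have l0 : (lead_coef P)^-1 != 0.
    by rewrite invr_eq0 lead_coef_eq0 -size_poly_gt0 ltnW.
  split; first by rewrite monicE lead_coefZ mulVf // -invr_eq0.
    case: Pi => sP Pi; split=> [|q q1 qP]; first by rewrite size_scale.
    rewrite (eqp_trans _ (_ : P %= _)) ?eqp_scale ?Pi //.
      by rewrite -(eqp_dvdr _ (eqp_scale P l0)).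
    by rewrite eqp_sym eqp_scale.
  by rewrite dvdpZl.
rewrite /irreducibleb P1 negb_forall => /existsP[q].
rewrite negb_imply -Pdiv.Idomain.dvdpE -ltnNge => /andP[qP q1].
have qs : (size q < m)%N.
  by rewrite (leq_trans _ Pm) // (leq_ltn_trans (size_npoly q)) // ltn_predL ltnW.
by have [Q [? ? Qq]] := IHm q qs q1; exists Q; split=> //; apply: dvdp_trans qP.
Qed.

Lemma irreducible_coprime (F : finFieldType) (P Q : {poly F}) :
  P \is monic -> Q \is monic -> irreducible_poly P -> irreducible_poly Q ->
  P != Q -> coprimep P Q.
Proof.
move=> Pm Qm Pi [sQ Qi]; rewrite irreducible_poly_coprime //; apply: contra => PQ.
have: P %= Q by apply: Qi => //; case: Pi => sP _; rewrite gtn_eqF.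
by rewrite eqp_monic.
Qed.

(** Unique factorization counted by degrees: the number of exponents [e.+1] whose power of w divides
    [P] is the multiplicity of w. Removing one irreducible factor [Q] lowers only the multiplicity
    of [Q], by one. *)
Lemma degree_sum_irreducible (F : finFieldType) (N n : nat) (P : {poly F}) :
    P \is monic -> size P = n.+1 -> (n <= N)%N ->
  n = (\sum_(d < N.+1) \sum_(w : 'rV[F]_d | irreducibleb (monic_of_row w))
        \sum_(e < N) (monic_of_row w ^+ e.+1 %| P)%R * d)%N.
Proof.
have [m] := ubnP n; elim: m n P => // m IHm n P /ltnSE-nm Pm Ps nN.
case: n => [|n] in nm Ps nN *.
  apply/esym/eqP; rewrite sum_nat_eq0; apply/forall_inP => d _.
  rewrite sum_nat_eq0; apply/forall_inP => w /irreducibleP[sw _].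
  rewrite sum_nat_eq0; apply/forall_inP => e _.
  have /eqP-> : P == 1 by rewrite -eqp_monic ?monic1 // -size_poly_eq1 Ps.
  rewrite dvdp1; case: (size _ =P 1%N) => [sP1|_]; last by rewrite mul0n.
  have := size_exp (monic_of_row w) e.+1.
  by rewrite sP1 size_monic_of_row /= => /esym/eqP; rewrite muln_eq0 orbF => /eqP->.
have [|Q [Qm Qi QP]] := @irreducible_factor _ P; first by rewrite Ps.
move: QP; rewrite dvdp_eq => /eqP; set G := P %/ Q => PE.
have Gm : G \is monic by move: Pm; rewrite PE monicMr.
have Q0 := monic_neq0 Qm; have G0 := monic_neq0 Gm.
have Q1 : (1 < size Q)%N by case: Qi.
have sP : (size G + size Q = n.+3)%N.
  by have := size_mul G0 Q0; rewrite -PE Ps; case: (_ + _)%N => // k /= <-.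
have sG : size G = (size G).-1.+1 by rewrite prednK // size_poly_gt0.
have {}IHm := IHm (size G).-1 G _ Gm sG _.
have cnt d (w : 'rV[F]_d) : irreducibleb (monic_of_row w) ->
    (\sum_(e < N) (monic_of_row w ^+ e.+1 %| P)%R * d =
     \sum_(e < N) (monic_of_row w ^+ e.+1 %| G)%R * d + (monic_of_row w == Q)%R * d)%N.
  move=> /irreducibleP wi; have wm := monic_of_row_monic w.
  case: eqP => [wQ|/eqP wQ]; last first.
    rewrite addn0; apply: eq_bigr => e _; congr (_ * _)%N; congr nat_of_bool.
    rewrite PE Gauss_dvdpl // coprimep_expl //.
    exact: irreducible_coprime.
  case: N nN {IHm} => // N nN; rewrite wQ mul1n big_ord_recl [in RHS]big_ord_recr /=.
  have -> : Q ^+ N.+1 %| G = false.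
    apply/negP => /(dvdp_leq G0); apply/negP; rewrite -ltnNge.
    have := size_exp Q N.+1; move: Q1 nN sP; case: (size Q) => [|[|k]] //.
    rewrite /= => _ nN sP sE; have : (0 < size (Q ^+ N.+1))%N by rewrite size_poly_gt0 expf_neq0.
    by move: nN sP sE; rewrite /= mulSn; move: (size G) (size (Q ^+ _)) (k * N.+1)%N => x y z; lia.
  rewrite expr1 mul0n addn0 PE dvdp_mulIr mul1n addnC; congr (_ + _)%N.
  apply: eq_bigr => e _; congr (_ * _)%N; congr nat_of_bool.
  by rewrite /bump /= exprS mulrC dvdp_mul2r.
under eq_bigr => d _ do under eq_bigr => w wi do rewrite cnt //.
under eq_bigr => d _ do rewrite big_split.
rewrite big_split /= -IHm; [|move: Q1 sP sG; lia..].
have Qd : ((size Q).-1 < N.+1)%N by move: Q1 sP sG nN; lia.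
have sQ : size Q = (size Q).-1.+1 by rewrite prednK // ltnW.
rewrite (bigD1 (Ordinal Qd)) //= (bigD1 (poly_rV Q)) /=; last first.
  by rewrite poly_rV_monicK //; apply/irreducibleP.
rewrite poly_rV_monicK // eqxx mul1n !big1 ?addn0.
- by move: Q1 sP sG; move: (size G) (size Q) => x y /=; lia.
- move=> d dQ; rewrite big1 // => w _; case: eqP => // wQ; case/eqP: dQ.
  by apply: val_inj; rewrite /= -wQ size_monic_of_row.
- by move=> w /andP[_ wQ]; case: eqP => // wE; case/eqP: wQ; rewrite -[LHS]monic_of_rowK wE.
Qed.

Lemma sum_multiples (V : nmodType) (g : nat -> V) n d : (0 < d)%N ->
  \sum_(k < n) (if (d %| k.+1)%N then g k.+1 else 0) =
  \sum_(e < n) (if (d * e.+1 <= n)%N then g (d * e.+1)%N else 0).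
Proof.
move=> d0.
transitivity (\sum_(k < n) \sum_(e < n | (k.+1 == d * e.+1 :> nat)%N) g k.+1).
  apply: eq_bigr => k _; case: ifP => [/dvdnP[j jk]|dk]; last first.
    by rewrite big1 // => e /eqP ek; move: dk; rewrite ek dvdn_mulr.
  have j0 : (0 < j)%N by case: j jk.
  have jn : (j.-1 < n)%N.
    by rewrite prednK // (leq_trans _ (ltn_ord k)) // jk leq_pmulr.
  rewrite (bigD1 (Ordinal jn)) /=; last by rewrite prednK // mulnC jk.
  rewrite big1 ?addr0 // => e /andP[/eqP ke /eqP[]]; apply: val_inj => /=.
  by move: jk; rewrite ke mulnC => /eqP; rewrite eqn_pmul2r // => /eqP <-.
rewrite (exchange_big_dep xpredT) //=; apply: eq_bigr => e _.
case: ifP => den; last first.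
  by rewrite big1 // => k /eqP ke; move: den; rewrite -ke ltn_ord.
have de0 : (0 < d * e.+1)%N by rewrite muln_gt0 d0.
have dn : ((d * e.+1).-1 < n)%N by rewrite prednK.
rewrite (bigD1 (Ordinal dn)) /=; last by rewrite prednK.
rewrite prednK // big1 ?addr0 // => k /andP[/eqP ke /eqP[]].
by apply: val_inj; rewrite /= -ke.
Qed.

(** The coefficient of T^n in the L-function attached to [L]. *)
Definition monic_sum (F : finFieldType) (C : nmodType) (L : {poly F} -> C) n : C :=
  \sum_(v : 'rV[F]_n) L (monic_of_row v).

(** The coefficient of T^n in T times the logarithmic derivative of the Euler product: the k-th
    power of an irreducible w of degree d contributes d L(w)^k in degree dk. *)
Definition prime_power_sum (F : finFieldType) (C : pzRingType) (L : {poly F} -> C) n : C :=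
  \sum_(d < n.+1) \sum_(w : 'rV[F]_d | irreducibleb (monic_of_row w))
    if (d %| n)%N then L (monic_of_row w) ^+ (n %/ d) *+ d else 0.

(* The logarithmic derivative of the Euler product, read on coefficients. *)
Lemma euler_recursion (F : finFieldType) (C : comPzRingType) (L : {poly F} -> C) :
    L 1 = 1 ->
    (forall P Q, P \is monic -> Q \is monic -> L (P * Q) = L P * L Q) ->
  forall n, \sum_(k < n) prime_power_sum L k.+1 * monic_sum L (n - k.+1) = monic_sum L n *+ n.
Proof.
move=> L1 LM n.
have LX P e : P \is monic -> L (P ^+ e) = L P ^+ e.
  by move=> Pm; elim: e => [//|e IHe]; rewrite !exprS LM ?monic_exp // IHe.
transitivity (\sum_(d < n.+1) \sum_(w : 'rV[F]_d | irreducibleb (monic_of_row w))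
   \sum_(e < n) if (d * e.+1 <= n)%N then
     L (monic_of_row w) ^+ e.+1 * monic_sum L (n - d * e.+1) *+ d else 0).
  transitivity (\sum_(k < n) \sum_(d < n.+1)
      \sum_(w : 'rV[F]_d | irreducibleb (monic_of_row w))
    if (d %| k.+1)%N then L (monic_of_row w) ^+ (k.+1 %/ d) * monic_sum L (n - k.+1) *+ d else 0).
    apply: eq_bigr => k _; rewrite /prime_power_sum.
    pose G d := \sum_(w : 'rV[F]_d | irreducibleb (monic_of_row w))
      (if (d %| k.+1)%N then L (monic_of_row w) ^+ (k.+1 %/ d) *+ d else 0).
    rewrite (big_ord_widen n.+1 G) ?ltnS // mulr_suml.
    rewrite [RHS](bigID (fun d : 'I__ => (d < k.+2)%N)) /=.
    rewrite [X in _ = _ + X]big1 ?addr0 => [|d]; last first.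
      rewrite -leqNgt => kd; rewrite big1 // => w _; case: ifP => // /dvdn_leq.
      by move=> /(_ isT); rewrite leqNgt (kd : (k.+1 < d)%N).
    apply: eq_bigr => d _; rewrite mulr_suml; apply: eq_bigr => w _.
    by case: ifP; rewrite ?mul0r // mulrnAl.
  rewrite exchange_big; apply: eq_bigr => d _ /=.
  rewrite exchange_big; apply: eq_bigr => w /irreducibleP[wi _] /=.
  have d0 : (0 < d)%N by move: wi; rewrite size_monic_of_row.
  rewrite (sum_multiples (fun k => L (monic_of_row w) ^+ (k %/ d) * monic_sum L (n - k) *+ d)) //.
  by apply: eq_bigr => e _; rewrite mulKn.
(* Each [v] is counted with the total degree of the irreducibles whose powers divide it, one for
   each power, hence [n] times. *)
transitivity (\sum_(v : 'rV[F]_n) \sum_(d < n.+1)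
     \sum_(w : 'rV[F]_d | irreducibleb (monic_of_row w)) \sum_(e < n)
     L (monic_of_row v) *+ ((monic_of_row w ^+ e.+1 %| monic_of_row v)%R * d)).
  rewrite [RHS]exchange_big; apply: eq_bigr => d _ /=.
  rewrite [RHS]exchange_big; apply: eq_bigr => w wi /=.
  rewrite [RHS]exchange_big; apply: eq_bigr => e _ /=.
  have wm := monic_of_row_monic w.
  transitivity ((\sum_(v : 'rV[F]_n | monic_of_row w ^+ e.+1 %| monic_of_row v)
      L (monic_of_row v)) *+ d).
    have sw : size (monic_of_row w ^+ e.+1) = (d * e.+1).+1.
      rewrite -[LHS]prednK ?size_poly_gt0 ?expf_neq0 ?monic_neq0 // size_exp.
      by rewrite size_monic_of_row.
    rewrite (sum_monic_dvd L n _ sw) ?monic_exp //; case: ifP; rewrite ?mul0rn //.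
    move=> _; congr (_ *+ _); rewrite mulr_sumr; apply: eq_bigr => u _.
    by rewrite LM ?monic_exp ?monic_of_row_monic // LX.
  rewrite -sumrMnl big_mkcond; apply: eq_bigr => v _.
  by case: (_ %| _); rewrite ?mul0n ?mul1n ?mulr0n.
rewrite -sumrMnl; apply: eq_bigr => v _.
have Ev := degree_sum_irreducible (monic_of_row_monic v) (size_monic_of_row v) (leqnn n).
rewrite [RHS](congr1 _ Ev).
rewrite -sumrMnr; apply: eq_bigr => d _; rewrite -sumrMnr.
by apply: eq_bigr => w _; rewrite -sumrMnr.
Qed.

(** * Passing to a finite extension *)

Lemma pchar_nat_card (K : finFieldType) : [pchar K].-nat #|K|.
Proof.
have [p pp pK] := finPcharP K.
rewrite (card_pprimeChar pK : #|K| = _) pnatX; apply/orP; left.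
by rewrite pnatE.
Qed.

(** The residue field of [P] has [#|F| ^ d] elements, so raising to the power [#|F| ^ n] fixes the
    class of 'X. *)
Lemma irreducible_dvd_Xcard (F : finFieldType) (P : {poly F}) d n :
    P \is monic -> irreducible_poly P -> size P = d.+1 -> (d %| n)%N ->
  P %| 'X^(#|F| ^ n) - 'X.
Proof.
move=> Pm Pi sP /dvdnP[k ->].
pose hI : monic_irreducible_poly P := (Pi, Pm).
have PE : mk_monic P = P by rewrite (mk_monicE hI).
have X1 (x : {poly %/ P with hI}) : x ^+ (#|F| ^ (k * d)) = x.
  rewrite mulnC expnM; have <- : #|{poly %/ P with hI}| = (#|F| ^ d)%N.
    by rewrite card_qfpoly sP.
  by elim: k => [|k IHk]; rewrite ?expr1 // expnS exprM expf_card IHk.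
have : in_qpoly P ('X^(#|F| ^ (k * d)) - 'X) = 0.
  by rewrite in_qpolyD linearN /= rmorphXn /= (X1 (in_qpoly P 'X)) subrr.
move=> /(congr1 val) /=; rewrite PE => /eqP.
by rewrite -/(Pdiv.CommonRing.rdvdp P _) -Pdiv.Idomain.dvdpE.
Qed.

Section FiniteExtension.

Variables (F K : finFieldType) (iota : {rmorphism F -> K}) (n : nat).
Hypotheses (n_gt0 : (0 < n)%N) (cardK : #|K| = (#|F| ^ n)%N).

Let frob (x : K) := x ^+ #|F|.

Lemma pchar_nat_base : [pchar K].-nat #|F|.
Proof.
apply: (pnat_dvd _ (pchar_nat_card K)).
by rewrite cardK -(prednK n_gt0) expnS dvdn_mulr.
Qed.

Lemma iter_frob t x : iter t frob x = x ^+ (#|F| ^ t).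
Proof. by elim: t => [|t IHt]; rewrite ?expr1 // iterS IHt expnSr exprM. Qed.

Lemma frob_inj : injective frob.
Proof.
apply: (@can_inj _ _ _ (iter n.-1 frob)) => x.
by rewrite -iterSr prednK // iter_frob -cardK expf_card.
Qed.

Fact frob_zmod : zmod_morphism frob.
Proof.
move=> x y; rewrite /frob exprDn_pchar ?pchar_nat_base //; congr (_ + _).
apply/eqP; rewrite -addr_eq0 -exprDn_pchar ?pchar_nat_base // addNr.
by rewrite expr0n; case: #|F| (finNzRing_gt1 F).
Qed.

Fact frob_monoid : monoid_morphism frob.
Proof. by split; rewrite /frob ?expr1n // => x y; rewrite exprMn. Qed.

Let frobM : {rmorphism K -> K} := HB.pack frob
  (GRing.isZmodMorphism.Build K K frob frob_zmod)
  (GRing.isMonoidMorphism.Build K K frob frob_monoid).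

Lemma frob_iota x : frob (iota x) = iota x.
Proof. by rewrite /frob -rmorphXn expf_card. Qed.

Lemma frob_fixed x : frob x = x -> exists y, iota y = x.
Proof.
move=> fx; have Xq : 'X^#|F| - 'X = \prod_(y : F) ('X - (iota y)%:P).
  have := congr1 (map_poly iota) (finField_genPoly F).
  rewrite rmorphB /= map_polyXn map_polyX rmorph_prod /= => ->.
  by apply: eq_bigr => y _; rewrite map_polyXsubC.
have : root (\prod_(y : F) ('X - (iota y)%:P)) x.
  by rewrite -Xq rootE !hornerE subr_eq0 -/(frob x) fx.
have -> : \prod_(y : F) ('X - (iota y)%:P) = 
          \prod_(z <- [seq iota y | y <- enum F]) ('X - z%:P).
  by rewrite big_map big_enum.
by rewrite root_prod_XsubC => /mapP[y _ ->]; exists y.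
Qed.

Lemma frob_root (P : {poly F}) x :
  root (map_poly iota P) x -> root (map_poly iota P) (frob x).
Proof.
move=> /rootP Px; rewrite -[P]mul1r; apply/rootP.
have -> : map_poly iota (1 * P) = map_poly frobM (map_poly iota P).
  by apply/polyP => i; rewrite !coef_map mul1r /= frob_iota.
by rewrite -[frob x]/(frobM x) horner_map Px rmorph0.
Qed.

(** This is the minimal polynomial of [x] over [F], with coefficients viewed in [K]. *)
Definition orbit_poly x := \prod_(y <- orbit frob x) ('X - y%:P).

(** Frobenius permutes the orbit and so fixes the coefficients; its fixed points form the image of
    [F]. *)
Lemma orbit_poly_descends x : exists P : {poly F},
  P \is monic /\ map_poly iota P = orbit_poly x.
Proof.
have fixO : map_poly frobM (orbit_poly x) = orbit_poly x.
  rewrite rmorph_prod.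
  transitivity (\prod_(y <- map frob (orbit frob x)) ('X - y%:P)).
    by rewrite big_map; apply: eq_bigr => y _; exact: (map_polyXsubC frobM).
  apply: perm_big; apply: uniq_perm; rewrite ?(map_inj_uniq frob_inj) ?orbit_uniq //.
  move=> y; rewrite -!fconnect_orbit; apply/mapP/idP => [[z xz ->]|xy].
    by rewrite -same_fconnect1_r ?fconnect_orbit //; exact: frob_inj.
  exists (finv frob y); last by rewrite f_finv //; exact: frob_inj.
  rewrite -fconnect_orbit (same_fconnect1_r frob_inj) f_finv //; exact: frob_inj.
have /fin_all_exists[c cE] (i : 'I_(size (orbit_poly x))) :
    exists y, iota y = (orbit_poly x)`_i.
  by apply: frob_fixed; have := congr1 (fun p : {poly K} => p`_i) fixO; rewrite coef_map.
pose P := \poly_(i < size (orbit_poly x)) oapp c 0 (insub i).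
have PE : map_poly iota P = orbit_poly x.
  apply/polyP => i; rewrite coef_map coef_poly; case: ltnP => [io|oi]; last first.
    by rewrite /= rmorph0 nth_default.
  by rewrite insubT /= cE.
exists P; split=> //; rewrite -(map_monic iota) PE.
exact: monic_prod_XsubC.
Qed.

Lemma size_orbit_poly x : size (orbit_poly x) = (order frob x).+1.
Proof. by rewrite size_prod_XsubC size_orbit. Qed.

Lemma order_frob_dvd x : (order frob x %| n)%N.
Proof.
have xn : iter n frob x = x by rewrite iter_frob -cardK expf_card.
rewrite /dvdn; have ro : (n %% order frob x < order frob x)%N by rewrite ltn_mod order_gt0.
rewrite -(findex_iter ro) (_ : iter _ _ x = x) ?findex0 //.
rewrite -[RHS]xn [in RHS](divn_eq n (order frob x)) addnC iterD; congr iter.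
elim: (n %/ _)%N => //= k IHk; rewrite mulSn iterD -IHk.
by rewrite iter_order //; exact: frob_inj.
Qed.

(** The characteristic polynomial is a power of the minimal one: the [n] conjugates run through the
    orbit [n %/ order frob x] times. *)
Lemma orbit_poly_exp x :
  orbit_poly x ^+ (n %/ order frob x) = \prod_(t < n) ('X - (x ^+ (#|F| ^ t))%:P).
Proof.
set e := order frob x.
have xe : iter e frob x = x by rewrite iter_order //; exact: frob_inj.
have -> : orbit_poly x = \prod_(t < e) ('X - (iter t frob x)%:P).
  rewrite /orbit_poly /orbit -/e (big_nth x) size_traject big_mkord.
  by apply: eq_bigr => t _; rewrite nth_traject.
have kE k : (\prod_(t < e) ('X - (iter t frob x)%:P)) ^+ k =
   \prod_(t < k * e) ('X - (iter t frob x)%:P).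
  elim: k => [|k IHk]; first by rewrite big_ord0.
  rewrite exprSr IHk mulSnr big_split_ord /=; congr (_ * _).
  apply: eq_bigr => t _; congr ('X - _%:P).
  rewrite addnC iterD; congr iter; elim: k {IHk} => // k IHk.
  by rewrite mulSnr iterD xe.
rewrite kE divnK ?order_frob_dvd //.
by apply: eq_bigr => t _; rewrite iter_frob.
Qed.

Lemma orbit_poly_dvd (P : {poly F}) x :
  root (map_poly iota P) x -> orbit_poly x %| map_poly iota P.
Proof.
move=> Px; apply: uniq_roots_dvdp; last by rewrite uniq_rootsE orbit_uniq.
apply/allP => _ /trajectP[t _ ->]; elim: t => //= t; exact: frob_root.
Qed.

Lemma irreducible_orbit_poly (P : {poly F}) x :
    P \is monic -> irreducible_poly P -> root (map_poly iota P) x ->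
  map_poly iota P = orbit_poly x.
Proof.
move=> Pm [sP Pi] Px; have [Q [Qm QE]] := orbit_poly_descends x.
have QP : Q %| P by rewrite -(dvdp_map iota) QE orbit_poly_dvd.
have : Q %= P.
  by apply: Pi => //; rewrite -(size_map_poly iota) QE size_orbit_poly eqSS -lt0n order_gt0.
by rewrite eqp_monic // => /eqP <-.
Qed.

Lemma descended_irreducible (P : {poly F}) x :
  P \is monic -> map_poly iota P = orbit_poly x -> irreducible_poly P.
Proof.
move=> Pm PE; have P0 := monic_neq0 Pm; split.
  by rewrite -(size_map_poly iota) PE size_orbit_poly ltnS order_gt0.
move=> q q1 qP; have q0 : q != 0 by apply: contraTneq qP => ->; rewrite dvd0p.
have /dvdp_prod_XsubC[m qm] : map_poly iota q %| orbit_poly x by rewrite -PE dvdp_map.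
have [y yo yq] : exists2 y, y \in orbit frob x & root (map_poly iota q) y.
  case: (mask m (orbit frob x)) (fun z => @mem_mask _ z m (orbit frob x)) qm => [|y s] sub qm.
    by move: q1; rewrite -(size_map_poly iota) (eqp_size qm) big_nil size_poly1.
  exists y; first by rewrite sub // mem_head.
  by rewrite (eqp_root qm) root_prod_XsubC mem_head.
rewrite /eqp qP -(dvdp_map iota) PE /=; apply: orbit_poly_dvd.
move: yo; rewrite -fconnect_orbit fconnect_sym; last exact: frob_inj.
by rewrite fconnect_orbit => /trajectP[t _ ->]; elim: t => //= t; exact: frob_root.
Qed.

(** The elements of [K] are grouped by minimal polynomial. An irreducible w of degree d dividing [n]
    has exactly d roots in [K], and at each of them [g] equals L(w)^(n/d) by [orbit_poly_exp]. *)
Lemma prime_power_sum_extension (C : comPzRingType) (L : {poly F} -> C) (g : K -> C) :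
    L 1 = 1 ->
    (forall P Q, P \is monic -> Q \is monic -> L (P * Q) = L P * L Q) ->
    (forall P x, P \is monic ->
      map_poly iota P = \prod_(t < n) ('X - (x ^+ (#|F| ^ t))%:P) -> L P = g x) ->
  prime_power_sum L n = \sum_x g x.
Proof.
move=> L1 LM Lg.
have LX P e : P \is monic -> L (P ^+ e) = L P ^+ e.
  by move=> Pm; elim: e => [//|e IHe]; rewrite !exprS LM ?monic_exp // IHe.
have gE (P : {poly F}) x : P \is monic -> irreducible_poly P ->
    root (map_poly iota P) x -> L P ^+ (n %/ order frob x) = g x.
  move=> Pm Pi Px; rewrite -LX //; apply: Lg; first exact: monic_exp.
  by rewrite rmorphXn /= (irreducible_orbit_poly Pm Pi Px) orbit_poly_exp.
transitivity (\sum_(d < n.+1) \sum_(w : 'rV[F]_d | irreducibleb (monic_of_row w))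
   \sum_(x | root (map_poly iota (monic_of_row w)) x) g x).
  apply: eq_bigr => d _; apply: eq_bigr => w /irreducibleP wi.
  have wm := monic_of_row_monic w.
  have rootd x : root (map_poly iota (monic_of_row w)) x -> order frob x = d.
    move=> wx; have := size_orbit_poly x.
    by rewrite -(irreducible_orbit_poly wm wi wx) size_map_poly size_monic_of_row => -[].
  case: ifP => dn; last first.
    by rewrite big_pred0 // => x; apply/negP => /rootd xd; rewrite -xd order_frob_dvd in dn.
  have [x0 wx0] : exists x, root (map_poly iota (monic_of_row w)) x.
    have := irreducible_dvd_Xcard wm wi (size_monic_of_row w) dn.
    rewrite -cardK -(dvdp_map iota) rmorphB /= map_polyXn map_polyX finField_genPoly.
    rewrite -big_enum => /dvdp_prod_XsubC[m wE].
    case: (mask m _) wE => [|y s] wE; last first.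
      by exists y; rewrite (eqp_root wE) root_prod_XsubC mem_head.
    case: wi => + _; rewrite -(size_map_poly iota) (eqp_size wE).
    by rewrite big_nil size_poly1.
  rewrite (eq_bigr (fun=> L (monic_of_row w) ^+ (n %/ d))); last first.
    by move=> x wx; rewrite -(gE (monic_of_row w)) // (rootd x wx).
  rewrite big_const iter_addr_0; congr (_ *+ _).
  rewrite -[LHS](rootd _ wx0) -size_orbit -(card_uniqP (orbit_uniq _ _)).
  apply: eq_card => y; rewrite [RHS]unfold_in (irreducible_orbit_poly wm wi wx0).
  by rewrite -[RHS]/(root (orbit_poly x0) y) root_prod_XsubC.
rewrite (eq_bigr (fun d : 'I_n.+1 => \sum_x \sum_(w : 'rV[F]_d | irreducibleb (monic_of_row w) &&
   root (map_poly iota (monic_of_row w)) x) g x)); last first.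
  by move=> d _; rewrite (exchange_big_dep xpredT).
rewrite exchange_big; apply: eq_bigr => x _ /=.
have [P [Pm PE]] := orbit_poly_descends x.
have Pi := descended_irreducible Pm PE.
have sP : size P = (order frob x).+1 by rewrite -(size_map_poly iota) PE size_orbit_poly.
have on : (order frob x < n.+1)%N by rewrite ltnS dvdn_leq ?order_frob_dvd.
have rootP_ d (w : 'rV[F]_d) :
    irreducibleb (monic_of_row w) && root (map_poly iota (monic_of_row w)) x -> monic_of_row w = P.
  case/andP => /irreducibleP wi wx; apply: (map_poly_inj iota).
  by rewrite PE; apply: irreducible_orbit_poly => //; apply: monic_of_row_monic.
rewrite (bigD1 (Ordinal on)) //= (bigD1 (poly_rV P)) /=; last first.
  rewrite poly_rV_monicK // PE root_prod_XsubC in_orbit andbT.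
  exact/irreducibleP.
rewrite !big1 ?addr0 // => [d dP|w /andP[/rootP_ wP wne]].
  rewrite big1 // => w /rootP_ wP; case/eqP: dP; apply: val_inj => /=.
  by move: sP; rewrite -wP size_monic_of_row => -[].
by case/eqP: wne; rewrite -[LHS]monic_of_rowK wP.
Qed.

End FiniteExtension.

(** * Stepanov's method *)

(** Induction on [s]: the earlier terms are already 0 and the later ones are divisible by
    ['X^(e s + al)], hence so is the term at [s]. As [U s] does not vanish at 0, ['X^al] divides
    [k s], which is too short unless it is 0. *)
Lemma lacunary_sum_eq0 (K : fieldType) N (e : nat -> nat) al (k U : 'I_N -> {poly K}) :
    (forall s, e s + al <= e s.+1)%N ->
    (forall s, size (k s) <= al)%N -> (forall s, (U s).[0] != 0) ->
    \sum_(s < N) 'X^(e s) * (k s * U s) = 0 ->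
  forall s, k s = 0.
Proof.
move=> ee ks U0 sum0 s; have [m] := ubnP s; elim: m s => // m IHm s /ltnSE-sm.
have eD t d : (e t + al <= e (t + d).+1)%N.
  elim: d => [|d IHd]; first by rewrite addn0.
  by rewrite addnS (leq_trans IHd) // (leq_trans _ (ee _)) // leq_addr.
have dvd_rest : 'X^(e s + al) %| \sum_(t < N | t != s) 'X^(e t) * (k t * U t).
  apply: (big_ind (fun p => _ %| p)) => [|p r|t ts]; [exact: dvdp0|exact: dvdp_add|].
  case: (ltnP t s) => [lts|]; first by rewrite IHm ?mul0r ?mulr0 ?dvdp0 // (leq_trans lts).
  rewrite leq_eqVlt => /predU1P[st|st]; first by rewrite -val_eqE /= st eqxx in ts.
  apply/dvdp_mulr/dvdp_exp2l; have := eD s (t - s.+1)%N.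
  by rewrite -addSn subnKC.
have : 'X^(e s + al) %| 'X^(e s) * (k s * U s).
  move: sum0; rewrite (bigD1 s) //= => /eqP; rewrite addr_eq0 => /eqP->.
  by rewrite dvdpNr.
rewrite exprD dvdp_mul2l ?expf_neq0 ?polyX_eq0 // Gauss_dvdpl; last first.
  apply: coprimep_expl; rewrite -['X]subr0 coprimep_sym coprimep_XsubC.
  by rewrite rootE U0.
have [->//|k0] := eqVneq (k s) 0; move=> /(dvdp_leq k0).
by rewrite size_polyXn ltnNge ks.
Qed.

Lemma size_mul_leS (R : nzRingType) (p q : {poly R}) a b :
  (size p <= a.+1)%N -> (size q <= b.+1)%N -> (size (p * q)%R <= (a + b).+1)%N.
Proof.
move=> pa qb; apply: leq_trans (size_polyMleq _ _) _.
by rewrite -ltnS -addnS -addSn; case: (size p + size q)%N (leq_add pa qb) => //= *; lia.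
Qed.

Lemma size_exp_leS (R : nzRingType) (p : {poly R}) a n :
  (size p <= a.+1)%N -> (size (p ^+ n)%R <= (n * a).+1)%N.
Proof.
by move=> pa; elim: n => [|n IHn]; rewrite ?size_poly1 // exprS mulSn; apply: size_mul_leS.
Qed.

Section Stepanov.

Variables (K : finFieldType) (Q M m B al : nat) (E E0 W E' W' : {poly K}).
Variable X : {set K}.
Hypotheses (Q_gt0 : (0 < Q)%N) (cardK : #|K| = (Q ^ 2)%N).
Hypotheses (M_gt0 : (0 < M)%N) (alM : (al * M <= Q)%N).
Hypotheses (EE0 : E = 'X^al * E0) (E00 : E0.[0] != 0) (W0 : W.[0] != 0).
Hypotheses (sE : (size E <= B.+1)%N) (sW : (size W <= B.+1)%N).
Hypotheses (sE' : (size E' <= B.+1)%N) (sW' : (size W' <= B.+1)%N).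
(* On X the Frobenius power [E^Q : W^Q] is projectively [E' : W']. *)
Hypothesis onX : forall x, x \in X -> exists l,
  E.[x] ^+ Q = l * E'.[x] /\ W.[x] ^+ Q = l * W'.[x].
Hypothesis unknowns : (Q * al + m + M * B < m * M * al)%N.

Let coefs : finType := {ffun 'I_(m * M) -> 'rV[K]_al}.

(* On X, where also x^(Q^2) = x, [T k ^ Q] is a multiple of [Z k].  Choosing k
   nonzero with [Z k = 0], which is possible by counting coefficients, gives a
   polynomial [T k] of controlled degree vanishing on X; it is nonzero because
   the orders at 0 of its terms are distinct. *)
Let T (k : coefs) : {poly K} := \sum_(s < m * M)
  'X^(Q * (s %/ M) + al * (s %% M)) *
  (rVpoly (k s) * (E0 ^+ (s %% M) * W ^+ (M.-1 - s %% M))).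

Let Z (k : coefs) : {poly K} := \sum_(s < m * M)
  rVpoly (k s) ^+ Q * ('X^(s %/ M) * (E' ^+ (s %% M) * W' ^+ (M.-1 - s %% M))).

Let pcharQ : [pchar K].-nat Q.
Proof.
have [p pp pK] := finPcharP K.
have pnK : p.-nat #|K| by rewrite (card_pprimeChar pK : #|K| = _) pnatX pnat_id.
have : p.-nat Q by apply: pnat_dvd pnK; rewrite cardK expnS dvdn_mulr.
by apply: sub_in_pnat => p' _; rewrite inE => /eqP->.
Qed.

(** [Z] raises the unknowns to the power [Q], so it is additive rather than linear. Additivity
    suffices: the pigeonhole principle gives two equal values, and the difference of the arguments
    lies in the kernel. *)
Let ZB k1 k2 : Z (k1 - k2) = Z k1 - Z k2.
Proof.
rewrite /Z -sumrB; apply: eq_bigr => s _; rewrite -mulrBl; congr (_ * _).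
have pcharQ' : [pchar {poly K}].-nat Q.
  by apply: sub_in_pnat pcharQ => p _; rewrite pchar_poly.
rewrite !ffunE linearB /= exprDn_pchar //; congr (_ + _).
apply/eqP; rewrite -addr_eq0 -exprDn_pchar // addNr expr0n.
by case: Q Q_gt0.
Qed.

Let smod s : (s %% M <= M.-1)%N.
Proof. by rewrite -ltnS prednK // ltn_mod. Qed.

Let divs (s : 'I_(m * M)) : (s %/ M < m)%N.
Proof. by rewrite ltn_divLR. Qed.

Let al_gt0 : (0 < al)%N.
Proof. by move: unknowns; case: al => //; rewrite !muln0. Qed.

Let size_Z k : (size (Z k) <= Q * al + m + M * B)%N.
Proof.
apply: (leq_trans (size_sum _ _ _)); apply/bigmax_leqP => s _.
have k_s : (size (rVpoly (k s)) <= (al.-1).+1)%N by rewrite prednK ?size_poly.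
apply: (leq_trans (size_mul_leS (size_exp_leS Q k_s) (size_mul_leS (_ : _ <= (s %/ M).+1)%N
   (size_mul_leS (size_exp_leS (s %% M) sE') (size_exp_leS (M.-1 - s %% M) sW')))));
  first by rewrite size_polyXn.
have -> : (s %% M * B + (M.-1 - s %% M) * B = M.-1 * B)%N by rewrite -mulnDl subnKC.
have -> : (Q * al = Q + Q * al.-1)%N by rewrite -mulnS prednK.
have -> : (M * B = B + M.-1 * B)%N by rewrite -mulSn prednK.
by have := divs s; move: (s %/ M)%N Q_gt0 => t; lia.
Qed.

Let exists_k : exists2 k : coefs, k != 0 & Z k = 0.
Proof.
pose N := (Q * al + m + M * B)%N; pose phi k := poly_rV (Z k) : 'rV[K]_N.
have : ~~ injectiveb phi.
  apply/negP => /injectiveP/leq_card; rewrite card_ffun !card_mx !mul1n card_ord.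
  by rewrite -expnM leq_exp2l ?finNzRing_gt1 // leqNgt mulnC unknowns.
case/injectivePn => k1 [k2 k12 phi12]; exists (k1 - k2); first by rewrite subr_eq0.
by rewrite ZB -[Z k1](poly_rV_K (size_Z k1)) -/(phi k1) phi12 poly_rV_K ?size_Z // subrr.
Qed.

Let T_neq0 k : k != 0 -> T k != 0.
Proof.
apply: contraNneq => Tk; apply/eqP/ffunP => s; rewrite ffunE -[LHS]rVpolyK.
rewrite (@lacunary_sum_eq0 _ _ (fun s => Q * (s %/ M) + al * (s %% M))%N al
  (fun s => rVpoly (k s)) (fun s => E0 ^+ (s %% M) * W ^+ (M.-1 - s %% M))
  _ _ _ Tk) ?linear0 // => {}s.
(* Consecutive exponents differ by [al] within a block of length [M], and by at least [al] between
   blocks because [al * M <= Q]. *)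
- rewrite divnS // modnS; case: ifP => _; last by rewrite mulnS addnA addnAC add0n.
  rewrite muln0 addn0 add1n mulnS -addnA [leqRHS]addnC leq_add2l -mulnSr.
  by apply: leq_trans alM; rewrite leq_mul2l ltn_mod M_gt0 orbT.
- exact: size_poly.
- by rewrite hornerM !horner_exp mulf_neq0 ?expf_neq0.
Qed.

Let exprQ_sum I (r : seq I) (f : I -> K) :
  (\sum_(i <- r) f i) ^+ Q = \sum_(i <- r) f i ^+ Q.
Proof.
apply: (big_morph (fun y => y ^+ Q)) => [x y|]; first exact: exprDn_pchar.
by rewrite expr0n; case: Q Q_gt0.
Qed.

(** Absorbing the powers of ['X^al] into those of [E0] makes [T] homogeneous of degree [M.-1] in [E]
    and [W], so the projective factor [l] comes out uniformly as [l ^+ M.-1]. *)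
Let T_vanishes k x : Z k = 0 -> x \in X -> (T k).[x] = 0.
Proof.
move=> Zk /onX[l [El Wl]].
suff: (T k).[x] ^+ Q = l ^+ M.-1 * (Z k).[x].
  by rewrite Zk horner0 mulr0 => /eqP; rewrite expf_eq0 Q_gt0 => /eqP.
rewrite !horner_sum exprQ_sum mulr_sumr; apply: eq_bigr => s _.
rewrite !hornerM !horner_exp !hornerX exprD.
have xQ i : (x ^+ (Q * i)) ^+ Q = x ^+ i.
  by rewrite -exprM mulnAC mulnn exprM -cardK expf_card.
have EX : E.[x] = x ^+ al * E0.[x] by rewrite EE0 hornerM horner_exp hornerX.
transitivity (x ^+ (s %/ M) * ((rVpoly (k s)).[x] ^+ Q *
   ((E.[x] ^+ Q) ^+ (s %% M) * (W.[x] ^+ Q) ^+ (M.-1 - s %% M)))).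
  rewrite -mulrA [X in _ * X](_ : _ = (rVpoly (k s)).[x] *
    (E.[x] ^+ (s %% M) * W.[x] ^+ (M.-1 - s %% M))); last first.
    by rewrite EX exprMn -exprM; ring.
  by rewrite !exprMn xQ ![(_ ^+ Q) ^+ _]exprAC.
rewrite El Wl !exprMn.
have -> : l ^+ M.-1 = l ^+ (s %% M) * l ^+ (M.-1 - s %% M) by rewrite -exprD subnKC.
by ring.
Qed.

Lemma stepanov_bound : (#|X| <= al + Q * m + M * B)%N.
Proof.
have [k k0 Zk] := exists_k; have Tk0 := T_neq0 k0.
have : (#|X| < size (T k))%N.
  rewrite cardE; apply: max_poly_roots => //; last exact: enum_uniq.
  by apply/allP => x; rewrite mem_enum => xX; apply/rootP; apply: T_vanishes.
move=> /leq_trans sT; apply: ltnW; rewrite -ltnS; apply: sT.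
rewrite /T; under eq_bigr => s _.
  rewrite exprD -mulrA (_ : 'X^(al * (s %% M)) * _ = 
    rVpoly (k s) * (E ^+ (s %% M) * W ^+ (M.-1 - s %% M))); last first.
    by rewrite EE0 exprMn -exprM; ring.
  over.
apply: (leq_trans (size_sum _ _ _)); apply/bigmax_leqP => s _.
have k_s : (size (rVpoly (k s)) <= (al.-1).+1)%N by rewrite prednK ?size_poly.
apply: (leq_trans (size_mul_leS (_ : _ <= (Q * (s %/ M)).+1)%N (size_mul_leS k_s
   (size_mul_leS (size_exp_leS (s %% M) sE) (size_exp_leS (M.-1 - s %% M) sW)))));
  first by rewrite size_polyXn.
have -> : (s %% M * B + (M.-1 - s %% M) * B = M.-1 * B)%N by rewrite -mulnDl subnKC.
have -> : (M * B = B + M.-1 * B)%N by rewrite -mulSn prednK.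
have : (Q * (s %/ M) <= Q * m)%N by rewrite leq_mul2l ltnW ?orbT.
by move: (Q * _)%N (Q * _)%N al_gt0 => u v; lia.
Qed.

End Stepanov.

(** The main term Q^2 / M is the fiber size expected from equidistribution over [M] values. *)
Lemma stepanov (K : finFieldType) (Q M b al : nat) (E E0 W E' W' : {poly K})
    (X : {set K}) :
    #|K| = (Q ^ 2)%N -> (0 < M)%N -> (al * M <= Q)%N -> (Q <= (al * M).+1)%N ->
    E = 'X^al * E0 -> E0.[0] != 0 -> W.[0] != 0 ->
    (size E <= (b * Q).+1)%N -> (size W <= (b * Q).+1)%N ->
    (size E' <= (b * Q).+1)%N -> (size W' <= (b * Q).+1)%N ->
    (forall x, x \in X -> exists l,
       E.[x] ^+ Q = l * E'.[x] /\ W.[x] ^+ Q = l * W'.[x]) ->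
    (M * b + 4 < Q)%N ->
  (#|X| * M <= Q ^ 2 + (M * (2 * (M * b) + 4)).+1 * Q)%N.
Proof.
move=> cardK M0 alM Qal EE0 E00 W0 sE sW sE' sW' onX Qbig.
have Q0 : (0 < Q)%N by apply: leq_ltn_trans Qbig.
have alQ : (al <= Q)%N by rewrite (leq_trans _ alM) // leq_pmulr.
have := stepanov_bound Q0 cardK M0 alM EE0 E00 W0 sE sW sE' sW' onX.
(* With this m, and since [al * M] is at least Q - 1, there are enough unknowns as soon as 2m < 4Q;
   this holds because [al <= Q] and [M * b + 4 < Q]. *)
move=> /(_ (al + (M * b + 4))%N) H.
have {}H : (#|X| <= al + Q * (al + (M * b + 4)) + M * (b * Q))%N.
  apply: H; rewrite -[ltnRHS]mulnA [(M * al)%N]mulnC [(M * (b * Q))%N]mulnA.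
  case: Q Q0 alQ Qbig Qal {cardK alM sE sW sE' sW' onX} => // q _.
  move: (M * b)%N (al * M)%N => u P alQ Qbig Qal.
  apply: (@leq_trans ((al + (u + 4)) * q)%N); last by rewrite leq_mul2l -ltnS Qal orbT.
  rewrite !mulnDl !mulnS mulSn mulnC; move: (al * q)%N (u * q)%N => x y; lia.
have -> : (Q ^ 2 + (M * (2 * (M * b) + 4)).+1 * Q = Q + Q * Q
   + Q * (M * b + 4) * M + M * b * Q * M)%N by rewrite mulSn; ring.
apply: (leq_trans (leq_mul H (leqnn M))).
have -> : ((al + Q * (al + (M * b + 4)) + M * (b * Q)) * M = al * M + Q * (al * M)
   + Q * (M * b + 4) * M + M * b * Q * M)%N by ring.
by rewrite !leq_add2r leq_add // leq_mul2l alM orbT.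
Qed.

Lemma finite_extension (p n : nat) (pp : prime p) : (0 < n)%N ->
  exists (K : finFieldType) (iota : {rmorphism 'F_p -> K}), #|K| = (p ^ n)%N.
Proof.
move=> n0; have [K pK cK] := pPrimePowerField pp n0.
by exists (pPrimeCharType pK : finFieldType), (GRing.in_alg (pPrimeCharType pK)).
Qed.

(** The sum is [prime_power_sum L 1], so up to sign a sum of fewer than [D] inverse roots. The
    estimates over the fields with (p^a)^2 elements, for all large a, bound each of them by sqrt
    p. *)
Lemma sum_linear_le (p : nat) (pp : prime p) (L : {poly 'F_p} -> algC)
    (D a0 C : nat) :
    L 1 = 1 ->
    (forall P Q, P \is monic -> Q \is monic -> L (P * Q) = L P * L Q) ->
    (forall n, (D <= n)%N -> monic_sum L n = 0) ->
    (forall a (K : finFieldType) (iota : {rmorphism 'F_p -> K}),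
      (a0 <= a)%N -> (0 < a)%N -> #|K| = (p ^ a.*2)%N -> exists2 g : K -> algC,
      (forall P x, P \is monic ->
        map_poly iota P = \prod_(t < a.*2) ('X - (x ^+ (p ^ t))%:P) -> L P = g x) &
      `|\sum_x g x| <= C%:R * (p ^ a)%:R) ->
  `|\sum_(x : 'F_p) L ('X - x%:P)| <= D%:R * sqrtC p%:R.
Proof.
move=> L1 LM LD Lg; have cF : #|'F_p| = p by rewrite card_Fp.
have -> : \sum_(x : 'F_p) L ('X - x%:P) = prime_power_sum L 1.
  rewrite (@prime_power_sum_extension _ _ idfun 1 isT _ _ L (fun x => L ('X - x%:P))) //.
  by move=> P x _; rewrite map_poly_id // big_ord1 expr1 => ->.
apply: (@L_function_bound D (monic_sum L) (prime_power_sum L) p C%:R (maxn a0 1)) => //.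
- exact: prime_gt0.
- rewrite /monic_sum (bigD1 0) //= big1 ?addr0 => [|v]; last by rewrite thinmx0 eqxx.
  by rewrite /monic_of_row linear0 addr0.
- by move=> n; rewrite euler_recursion.
move=> a; rewrite geq_max => /andP[a0a a_gt0].
have n_gt0 : (0 < a.*2)%N by rewrite double_gt0.
have [K [iota cK]] := finite_extension pp n_gt0.
have [g gL gs] := Lg a K iota a0a a_gt0 cK.
by rewrite (@prime_power_sum_extension _ _ iota a.*2 n_gt0 _ _ L g) ?cF // -?natrX.
Qed.

(** * Weil bounds *)

(** Since [chi] sums to 0 over [Y], each fiber size times [#|Y|] can be replaced by its deficit
    below [D]. Deficits are nonnegative and add up to [#|Y| * (D - #|G|)], so absolute values lose
    nothing more. *)
Lemma fiber_sum_le (T S : finType) (G : {set T}) (Y : {set S}) (t : T -> S)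
    (chi : S -> algC) (D : nat) :
    (forall x, x \in G -> t x \in Y) -> (forall y, y \in Y -> `|chi y| <= 1) ->
    \sum_(y in Y) chi y = 0 -> (0 < #|Y|)%N ->
    (forall y, y \in Y -> #|[set x in G | t x == y]| * #|Y| <= D)%N ->
  `|\sum_(x in G) chi (t x)| <= (D - #|G|)%:R.
Proof.
move=> GY chi1 sum0 Y0 fib.
have cG : #|G| = (\sum_(y in Y) #|[set x in G | t x == y]|)%N.
  rewrite -sum1_card (partition_big t (mem Y)) //=; apply: eq_bigr => y _.
  by rewrite -sum1_card; apply: eq_bigl => x; rewrite inE.
have sE : (\sum_(x in G) chi (t x)) * #|Y|%:R =
    - \sum_(y in Y) (D - #|[set x in G | t x == y]| * #|Y|)%:R * chi y.
  rewrite (partition_big t (mem Y)) //= mulr_suml.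
  apply/eqP; rewrite -addr_eq0 -big_split /=; apply/eqP.
  transitivity (\sum_(y in Y) D%:R * chi y); last by rewrite -mulr_sumr sum0 mulr0.
  apply: eq_bigr => y yY.
  rewrite (eq_bigr (fun=> chi y)) => [|x /andP[_ /eqP->]//].
  rewrite natrB ?fib // natrM mulrBl big_const iter_addr_0.
  rewrite (eq_card (_ : _ =i [set x in G | t x == y])) => [|x]; last by rewrite !inE.
  by rewrite -[_ *+ _]mulr_natr; ring.
have Y0' : (0 : algC) < #|Y|%:R by rewrite ltr0n.
rewrite -(ler_pM2r Y0') -[X in `|_| * X]normr_nat -normrM sE normrN.
apply: le_trans (ler_norm_sum _ _ _) _.
apply: (@le_trans _ _ (\sum_(y in Y) (D - #|[set x in G | t x == y]| * #|Y|)%:R)).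
  by apply: ler_sum => y yY; rewrite normrM normr_nat ler_piMr ?ler0n ?chi1.
rewrite -natr_sum -natrM ler_nat sumnB // sum_nat_const mulnBl -big_distrl /= -cG.
by rewrite mulnC.
Qed.

(** Translation by [c *: R] permutes the monic polynomials of degree [n]; averaging over [c] reduces
    the claim to lines in the direction [R]. *)
Lemma monic_sum_eq0 (F : finFieldType) (L : {poly F} -> algC) n (R : {poly F}) :
    (size R <= n)%N ->
    (forall P, P \is monic -> size P = n.+1 -> \sum_c L (P + c *: R) = 0) ->
  monic_sum L n = 0.
Proof.
move=> sR LR; have F0 : (#|F|%:R : algC) != 0.
  by rewrite pnatr_eq0 -lt0n ltnW // finNzRing_gt1.
apply: (mulIf F0); rewrite mul0r mulr_natr.
transitivity (\sum_c \sum_(v : 'rV[F]_n) L (monic_of_row v + c *: R)).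
  rewrite (eq_bigr (fun=> monic_sum L n)) => [|c _]; first by rewrite sumr_const.
  rewrite /monic_sum [RHS](reindex_inj (addrI (c *: poly_rV R))) /=.
  apply: eq_bigr => v _; congr L; rewrite /monic_of_row linearD linearZ /=.
  by rewrite poly_rV_K // -addrA [_ + c *: R]addrC.
rewrite exchange_big big1 // => v _; apply: LR; first exact: monic_of_row_monic.
exact: size_monic_of_row.
Qed.

Lemma sum_char_eq0 (F : finFieldType) (chi : F -> algC) :
    (forall x y, chi (x * y) = chi x * chi y) -> chi 0 = 0 ->
    (exists2 y, y != 0 & chi y != 1) ->
  \sum_(y in [set~ 0]) chi y = 0.
Proof.
move=> chiM chi0 [z z0 zn1].
have -> : \sum_(y in [set~ 0]) chi y = \sum_y chi y.
  by rewrite [RHS](bigD1 0) //= chi0 add0r; apply: eq_bigl => y; rewrite !inE.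
apply/eqP; have: chi z * \sum_y chi y == \sum_y chi y.
  rewrite mulr_sumr [eqbRHS](reindex_inj (mulfI z0)) /=.
  by apply/eqP; apply: eq_bigr => y _; rewrite chiM.
by rewrite -subr_eq0 -[X in _ - X]mul1r -mulrBl mulf_eq0 subr_eq0 (negPf zn1).
Qed.

Lemma pnat_pchar_Fp (p t : nat) (pp : prime p) (K : nzRingType)
  (iota : {rmorphism 'F_p -> K}) : [pchar K].-nat (p ^ t)%N.
Proof.
have pK : p \in [pchar K] by apply: (rmorph_pchar iota); apply: pchar_Fp.
by rewrite pnatX pnatE // pK.
Qed.

Lemma expr_card_iter_Fp (p t : nat) (pp : prime p) (v : 'F_p) : v ^+ (p ^ t) = v.
Proof.
elim: t => [|t IHt]; rewrite ?expr1 // expnS exprM.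
by rewrite -[X in v ^+ X](card_Fp pp) expf_card.
Qed.

Lemma exprD_iota (p t : nat) (pp : prime p) (K : comNzRingType)
  (iota : {rmorphism 'F_p -> K}) x v : (x + iota v) ^+ (p ^ t) = x ^+ (p ^ t) + iota v.
Proof. by rewrite (exprDn_pchar _ _ (pnat_pchar_Fp t pp iota)) -rmorphXn expr_card_iter_Fp. Qed.

Lemma size_prod_XaddC (K : nzRingType) (I : Type) (r : seq I) (c : I -> K) :
  size (\prod_(i <- r) ('X + (c i)%:P)) = (size r).+1.
Proof.
rewrite -(size_prod_XsubC _ (fun i => - c i)); congr (size (polyseq _)).
by apply: eq_bigr => i _; rewrite polyCN opprK.
Qed.

Lemma horner0_prod_XaddC_neq0 (K : idomainType) (I : eqType) (r : seq I) (c : I -> K) :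
  {in r, forall i, c i != 0} -> (\prod_(i <- r) ('X + (c i)%:P)).[0] != 0.
Proof.
by move=> c0; rewrite horner_prod prodf_seq_neq0; apply/allP => i /c0; rewrite !hornerE.
Qed.

Lemma horner_prod_XaddC_eq0 (K : idomainType) (I : eqType) (r : seq I) (c : I -> K) i :
  i \in r -> (\prod_(i <- r) ('X + (c i)%:P)).[- c i] = 0.
Proof.
by move=> ir; rewrite horner_prod (big_rem i) //= !hornerE addNr mul0r.
Qed.

Section MultiplicativeWeil.

Variables (p : nat) (pp : prime p).
Local Notation F := 'F_p.
Variable chi : F -> algC.
Hypotheses (chi1 : chi 1 = 1) (chi0 : chi 0 = 0).
Hypothesis chiM : forall x y, chi (x * y) = chi x * chi y.
Hypothesis chi_nontrivial : exists2 y, y != 0 & chi y != 1.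
Hypothesis chi_le1 : forall y, `|chi y| <= 1.
Variable vs : seq F.
Hypothesis vs0 : 0 \notin vs.

(** Up to the sign inserted here, P(-v) is the product of root + v over the roots of [P]. Hence [L]
    is multiplicative and its value at 'X - x is the summand of the Weil sum. *)
Let L (P : {poly F}) : algC :=
  \prod_(v <- 0 :: vs) chi ((-1) ^+ (size P).-1 * P.[- v]).

Let L1 : L 1 = 1.
Proof. by rewrite /L big1 // => v _; rewrite size_poly1 hornerC mulr1 expr0. Qed.

Let LM P Q : P \is monic -> Q \is monic -> L (P * Q) = L P * L Q.
Proof.
move=> Pm Qm; rewrite /L -big_split; apply: eq_bigr => v _ /=.
rewrite -chiM size_monicM ?monic_neq0 // hornerM.
have -> : ((size P + size Q).-1.-1 = (size P).-1 + (size Q).-1)%N.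
  have := monic_neq0 Pm; have := monic_neq0 Qm; rewrite -!size_poly_gt0.
  by case: (size P) (size Q) => [|a] [|b] // _ _; rewrite addSn addnS.
by rewrite exprD; congr chi; ring.
Qed.

Let W : {poly F} := \prod_(v <- undup vs) ('X + v%:P).

Let W_size : size W = (size (undup vs)).+1.
Proof. exact: size_prod_XaddC. Qed.

Let W0 : W.[0] != 0.
Proof.
apply: horner0_prod_XaddC_neq0 => v; rewrite mem_undup.
by apply: contraTneq => ->.
Qed.

Let WN v : v \in vs -> W.[- v] = 0.
Proof. by move=> vvs; apply: (horner_prod_XaddC_eq0 id); rewrite mem_undup. Qed.

Let size_shift (P R : {poly F}) n c : P \is monic -> size P = n.+1 -> (size R <= n)%N ->
  size (P + c *: R) = n.+1.
Proof.
move=> Pm sP sR; rewrite size_polyDl // sP ltnS (leq_trans (size_scale_leq _ _)) //.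
Qed.

(** [W] vanishes at every [- v] but not at 0, so adding [c *: W] changes only the factor of [L] at
    0, which then runs through a complete character sum. Taking each shift once in [W] is why
    repetitions in [vs] cost nothing. *)
Let monsumL n : ((size (undup vs)).+1 <= n)%N -> monic_sum L n = 0.
Proof.
move=> vn; have sW : (size W <= n)%N by rewrite W_size.
apply: (monic_sum_eq0 sW) => P Pm sP; pose s : F := (-1) ^+ n.
have s0 : s != 0 by rewrite expf_neq0 // oppr_eq0 oner_eq0.
transitivity (\sum_c chi (s * (P.[0] + c * W.[0])) * \prod_(v <- vs) chi (s * P.[- v])).
  apply: eq_bigr => c _; rewrite /L big_cons (size_shift _ Pm sP sW) oppr0 !hornerE /=.
  congr (_ * _); rewrite big_seq [RHS]big_seq; apply: eq_bigr => v vvs.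
  by rewrite !hornerE WN // mulr0 addr0.
rewrite -mulr_suml -(big_mkcond xpredT) /=.
rewrite -[X in X * _](_ : \sum_y chi y = _); last first.
  rewrite (reindex_inj (mulfI s0)) (reindex_inj (addrI P.[0])) (reindex_inj (mulIf W0)).
  by [].
rewrite (bigD1 0) //= chi0 add0r -[X in X * _](_ : \sum_(y in [set~ 0]) chi y = _).
  by rewrite sum_char_eq0 // mul0r.
by apply: eq_bigl => y; rewrite !inE.
Qed.

Section Extension.

Variables (a : nat) (K : finFieldType) (iota : {rmorphism F -> K}).
Hypotheses (a_gt0 : (0 < a)%N) (cardK : #|K| = (p ^ a.*2)%N).

Let Q := (p ^ a)%N.
(** These exponents are (Q-1)/(p-1) and, for [nu], (Q^2-1)/(p-1); the power [nu] is the norm from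
    [K] to [F]. *)
Let al := (\sum_(t < a) p ^ t)%N.
Let nu := (\sum_(t < a.*2) p ^ t)%N.
Let f0 : {poly K} := \prod_(v <- vs) ('X + (iota v)%:P).
Let f := 'X * f0.

Let alM : (al * p.-1 = Q.-1)%N. Proof. by rewrite mulnC -predn_exp. Qed.

Let p1_gt0 : (0 < p.-1)%N. Proof. by case: p (prime_gt1 pp) => [|[]]. Qed.

Let Q_gt0 : (0 < Q)%N. Proof. by rewrite expn_gt0 prime_gt0. Qed.

Let cardK2 : #|K| = (Q ^ 2)%N. Proof. by rewrite cardK /Q -expnM muln2. Qed.

Let nuE : nu = (al * Q.+1)%N.
Proof.
apply/eqP; rewrite -(eqn_pmul2l p1_gt0) -predn_exp mulnA [(p.-1 * al)%N]mulnC alM.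
rewrite -cardK cardK2 -mulnn; case: Q Q_gt0 => // q _.
by rewrite mulSn /= -mulnS.
Qed.

Let nu_gt0 : (0 < nu)%N.
Proof.
by rewrite -(ltn_pmul2l p1_gt0) muln0 -predn_exp -cardK -subn1 subn_gt0 finNzRing_gt1.
Qed.

Let f00 : f0.[0] != 0.
Proof.
apply: horner0_prod_XaddC_neq0 => v; rewrite fmorph_eq0.
by apply: contraTneq => ->.
Qed.

Let size_f0 : size f0 = (size vs).+1.
Proof. exact: size_prod_XaddC. Qed.

Let f0_neq0 : f0 != 0.
Proof. by rewrite -size_poly_gt0 size_f0. Qed.

Let size_f : size f = (size vs).+2.
Proof. by rewrite /f mulrC size_mulX // size_f0. Qed.

Let fnu_descends x : exists y, iota y = f.[x] ^+ nu.
Proof.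
apply: frob_fixed; rewrite /= card_Fp // -exprM -[X in (nu * X)%N](prednK (prime_gt0 pp)).
rewrite mulnS mulnC -predn_exp -cardK exprD.
have [-> | fx0] := eqVneq f.[x] 0.
  by rewrite expr0n /nu; case: a a_gt0 => // a' _; rewrite doubleS big_ord_recl expn0 mul0r.
rewrite [X in _ * X](_ : _ = 1) ?mulr1 //; apply: (mulfI fx0).
by rewrite -exprS prednK ?expf_card ?mulr1 // ltnW // finNzRing_gt1.
Qed.

(** Here [g x] is [chi] of the norm of [f.[x]]. On the fiber over y, [E = f ^+ al] satisfies E^(Q+1)
    = y by [nuE], that is, (E^Q : 1) = (y : E) projectively: the input of Stepanov's method with
    [M = p.-1]. *)
Lemma extension_sum_mult (Qbig : (p.-1 * (size vs).+1 + 4 < Q)%N) :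
  exists2 g : K -> algC,
    (forall P x, P \is monic ->
       map_poly iota P = \prod_(t < a.*2) ('X - (x ^+ (p ^ t))%:P) -> L P = g x) &
    `|\sum_x g x| <= ((p.-1 * (2 * (p.-1 * (size vs).+1) + 4)).+1 + (size vs).+1)%:R * Q%:R.
Proof.
have /fin_all_exists[t tE] := fnu_descends.
exists (fun x => chi (t x)) => [P x Pm PE|].
  rewrite /L -(big_morph chi chiM chi1); congr chi; apply: (fmorph_inj iota).
  have sP : size P = a.*2.+1.
    by rewrite -(size_map_poly iota) PE -big_enum size_prod_XsubC size_enum_ord.
  rewrite rmorph_prod tE /nu sP /= -signr_odd odd_double expr0.
  rewrite -prodrXr /f hornerM hornerX /f0 horner_prod.
  have -> : x * \prod_(v <- vs) ('X + (iota v)%:P).[x] = \prod_(v <- 0 :: vs) (x + iota v).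
    by rewrite big_cons rmorph0 addr0; congr (_ * _); apply: eq_bigr => v _; rewrite !hornerE.
  under [RHS]eq_bigr do rewrite -prodrXl.
  rewrite [RHS]exchange_big /=; apply: eq_bigr => v _; rewrite mul1r.
  rewrite -horner_map /= PE rmorphN horner_prod.
  rewrite [RHS](eq_bigr (fun t : 'I_a.*2 => - ('X - (x ^+ (p ^ t))%:P).[- iota v])) => [|i _].
    by rewrite prodrN card_ord -signr_odd odd_double expr0 mul1r.
  by rewrite !hornerE exprD_iota // opprB opprK addrC.
pose G := [set x | f.[x] != 0]; pose M := p.-1; pose b := (size vs).+1.
pose C := (M * (2 * (M * b) + 4)).+1.
have -> : \sum_x chi (t x) = \sum_(x in G) chi (t x).
  rewrite (bigID (mem G)) /= addrC big1 ?add0r // => x; rewrite inE negbK => /eqP fx.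
  have -> : t x = 0; last exact: chi0.
  apply: (fmorph_inj iota); rewrite tE fx rmorph0 expr0n.
  by rewrite gtn_eqF.
have cY : #|[set~ 0 : F]| = M by rewrite cardsC1 card_Fp.
have f_nz : f != 0 by rewrite -size_poly_gt0 size_f.
have cG : (Q ^ 2 <= #|G| + b)%N.
  rewrite -cardK2 -(cardsC G) leq_add2l -ltnS -size_f cardE.
  apply: max_poly_roots => //; last exact: enum_uniq.
  by apply/allP => x; rewrite mem_enum !inE negbK.
apply: le_trans (@fiber_sum_le _ _ G [set~ 0] t chi (Q ^ 2 + C * Q) _ _ _ _ _) _.
- move=> x; rewrite !inE => fx; rewrite -(fmorph_eq0 iota) tE.
  by rewrite expf_neq0.
- by [].
- exact: sum_char_eq0.
- by rewrite cY.
- move=> y; rewrite !inE cY => y0.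
  pose E := f ^+ al.
  have sE : (size E <= (b * Q).+1)%N.
    apply: (leq_trans (size_exp_leS al (_ : size f <= b.+1)%N)); first by rewrite size_f.
    rewrite ltnS mulnC leq_mul2l; apply/orP; right.
    by rewrite -(leq_pmul2r p1_gt0) alM (leq_trans (leq_pred _)) // leq_pmulr.
  apply: (@stepanov K Q M b al E (f0 ^+ al) 1 (iota y)%:P E) => //.
  + by rewrite alM leq_pred.
  + by rewrite alM prednK.
  + by rewrite /E /f exprMn.
  + by rewrite horner_exp expf_neq0.
  + by rewrite hornerC oner_eq0.
  + by rewrite size_poly1.
  + by rewrite (leq_trans (size_polyC_leq1 _)).
  move=> x; rewrite !inE => /andP[_ /eqP txy]; exists (E.[x] ^+ Q / iota y).
  have iy0 : iota y != 0 by rewrite fmorph_eq0.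
  rewrite !hornerC expr1n divfK //; split=> //.
  rewrite mulrAC -exprSr /E horner_exp -exprM -nuE -tE txy divff //.
rewrite -natrM ler_nat leq_subLR mulnDl addnA -[(Q ^ 2 + _)%N]addnC -/C.
have bQ : (b <= b * Q)%N by rewrite leq_pmulr.
by move: cG bQ; rewrite -/b; move: (C * Q)%N (b * Q)%N (Q ^ 2)%N => u v w; lia.
Qed.

End Extension.

Lemma weil_mult : `|\sum_x chi x * \prod_(v <- vs) chi (x + v)| <=
   (size (undup vs)).+1%:R * sqrtC p%:R.
Proof.
have -> : \sum_x chi x * \prod_(v <- vs) chi (x + v) = \sum_x L ('X - x%:P).
  apply: eq_bigr => x _; rewrite /L big_cons size_XsubC expr1 mulN1r !hornerE oppr0 sub0r opprK.
  by congr (_ * _); apply: eq_bigr => v _; rewrite !hornerE mulN1r opprB opprK addrC.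
(* The threshold is the left side of [Qbig], which holds from there on because a < p^a. *)
apply: (sum_linear_le pp L1 LM monsumL (a0 := p.-1 * (size vs).+1 + 4)).
move=> a K iota a0a a_gt0 cK.
apply: extension_sum_mult => //.
by apply: leq_ltn_trans a0a _; rewrite ltn_expl // prime_gt1.
Qed.

End MultiplicativeWeil.

Lemma logderiv_prod_XsubC (K : fieldType) (I : Type) (r : seq I) (c : I -> K) y :
    (\prod_(i <- r) ('X - (c i)%:P)).[y] != 0 ->
  (\prod_(i <- r) ('X - (c i)%:P))^`().[y] / (\prod_(i <- r) ('X - (c i)%:P)).[y] =
  \sum_(i <- r) (y - c i)^-1.
Proof.
elim: r => [|i r IHr]; first by rewrite !big_nil -polyC1 derivC horner0 mul0r.
rewrite !big_cons hornerM mulf_eq0 negb_or => /andP[yi yr].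
rewrite derivM hornerD !hornerM derivXsubC hornerC mul1r -IHr //.
by rewrite !hornerXsubC in yi *; field; rewrite ?yi ?yr.
Qed.

Section AdditiveWeil.

Variables (p : nat) (pp : prime p).
Local Notation F := 'F_p.
Variable psi : F -> algC.
Hypotheses (psi0 : psi 0 = 1).
Hypothesis psiD : forall x y, psi (x + y) = psi x * psi y.
Hypothesis psi_nontrivial : exists y, psi y != 1.
Hypothesis psi_le1 : forall y, `|psi y| <= 1.
Lemma sum_add_char_eq0 : \sum_y psi y = 0.
Proof.
have [z zn1] := psi_nontrivial.
apply/eqP; have: psi z * \sum_y psi y == \sum_y psi y.
  rewrite mulr_sumr [eqbRHS](reindex_inj (addrI z)) /=.
  by apply/eqP; apply: eq_bigr => y _; rewrite psiD.
by rewrite -subr_eq0 -[X in _ - X]mul1r -mulrBl mulf_eq0 subr_eq0 (negPf zn1).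
Qed.

Variable vs : seq F.
Hypothesis vs0 : 0 \notin vs.

Let good (P : {poly F}) := all (fun v => P.[- v] != 0) (0 :: vs).

(** Each summand is the sum of 1/(root + v) over the roots of [P], so it is additive in [P] and
    equals 1/(x + v) at 'X - x. A zero of [P] at some [- v] is a pole of the argument and gives the
    value 0. *)
Let L (P : {poly F}) : algC :=
  if good P then psi (\sum_(v <- 0 :: vs) - (P^`().[- v] / P.[- v])) else 0.

Let L1 : L 1 = 1.
Proof.
rewrite /L /good; have -> : all (fun v => (1 : {poly F}).[- v] != 0) (0 :: vs).
  by apply/allP => v _; rewrite hornerC oner_eq0.
by rewrite -polyC1 derivC big1 // => v _; rewrite horner0 mul0r oppr0.
Qed.

Let LM P Q : P \is monic -> Q \is monic -> L (P * Q) = L P * L Q.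
Proof.
move=> _ _; have gM : good (P * Q) = good P && good Q.
  by rewrite /good -all_predI; apply: eq_all => v /=; rewrite hornerM mulf_eq0 negb_or.
rewrite /L gM; case: (boolP (good P)) => /= gP; last by rewrite mul0r.
case: ifP => gQ; last by rewrite mulr0.
rewrite -psiD -big_split big_seq [in RHS]big_seq; congr psi; apply: eq_bigr => v vv.
have /= := allP gP v vv; have /= := allP gQ v vv; move=> Qv Pv.
by rewrite derivM hornerD !hornerM; field; rewrite Qv Pv.
Qed.

Let W : {poly F} := \prod_(v <- undup vs) ('X + v%:P).
Let R : {poly F} := W ^+ 2 * 'X.

Let W_size : size W = (size (undup vs)).+1.
Proof. exact: size_prod_XaddC. Qed.

Let W0 : W.[0] != 0.
Proof.
apply: horner0_prod_XaddC_neq0 => v; rewrite mem_undup.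
by apply: contraTneq => ->.
Qed.

Let WN v : v \in vs -> W.[- v] = 0.
Proof. by move=> vvs; apply: (horner_prod_XaddC_eq0 id); rewrite mem_undup. Qed.

Let R_size : (size R <= (2 * size (undup vs)).+2)%N.
Proof.
rewrite (leq_trans (size_polyMleq _ _)) // size_polyX addn2 /= ltnS.
by apply: size_exp_leS; rewrite W_size.
Qed.

(** [R] has multiple zeros at the [- v] and a simple one at 0. Adding [c *: R] preserves all values
    of [P] at these points and all derivatives except the one at 0, which moves by c W(0)^2; a
    complete additive character sum results. *)
Let monsumL n : ((2 * size (undup vs)).+2 <= n)%N -> monic_sum L n = 0.
Proof.
move=> vn; have sR := leq_trans R_size vn.
apply: (monic_sum_eq0 sR) => P Pm sP.
have RN v : v \in 0 :: vs -> R.[- v] = 0.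
  rewrite inE => /predU1P[->|vvs]; rewrite hornerM horner_exp; last by rewrite WN // expr0n mul0r.
  by rewrite hornerX oppr0 mulr0.
have dRN v : v \in vs -> R^`().[- v] = 0.
  by move=> vvs; rewrite derivM expr2 derivM !hornerE WN // !(mul0r, mulr0, addr0).
have dR0 : R^`().[0] = W.[0] ^+ 2.
  by rewrite derivM derivX mulr1 hornerD hornerM hornerX mulr0 add0r horner_exp.
have gP c : good (P + c *: R) = good P.
  by apply: eq_in_all => v vv; rewrite hornerD hornerZ RN // mulr0 addr0.
have [gP0|gP0] := boolP (good P); last first.
  by rewrite big1 // => c _; rewrite /L gP (negPf gP0).
have P0 : P.[0] != 0 by move/allP: gP0 => /(_ 0 (mem_head _ _)); rewrite oppr0.
pose k := - (W.[0] ^+ 2 / P.[0]).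
have k0 : k != 0 by rewrite oppr_eq0 mulf_neq0 ?invr_eq0 ?expf_neq0.
transitivity (\sum_c psi (\sum_(v <- 0 :: vs) - (P^`().[- v] / P.[- v])) * psi (c * k)).
  apply: eq_bigr => c _; rewrite /L gP gP0 -psiD !big_cons oppr0; congr psi.
  rewrite [in LHS]hornerD hornerZ -[X in R.[X]]oppr0 RN ?mem_head // mulr0 addr0.
  rewrite derivD derivZ hornerD hornerZ dR0 /k mulrDl opprD mulrN mulrA -!addrA.
  congr (_ + _); rewrite addrC; congr (_ + _); last by rewrite expr2 !mulrA.
  rewrite big_seq [RHS]big_seq; apply: eq_bigr => v vv.
  by rewrite !hornerD !hornerZ dRN // RN ?mulr0 ?addr0 // inE vv orbT.
rewrite -mulr_sumr; suff -> : \sum_c psi (c * k) = 0 by rewrite mulr0.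
have <- : \sum_y psi y = \sum_c psi (c * k) by rewrite [LHS](reindex_inj (mulIf k0)).
exact: sum_add_char_eq0.
Qed.

Section Extension.

Variables (a : nat) (K : finFieldType) (iota : {rmorphism F -> K}).
Hypotheses (a_gt0 : (0 < a)%N) (cardK : #|K| = (p ^ a.*2)%N).

Let Q := (p ^ a)%N.
Let al := (p ^ a.-1)%N.
Let f0 : {poly K} := \prod_(v <- vs) ('X + (iota v)%:P).
Let f := 'X * f0.
Let u x := f^`().[x] / f.[x].

Let alM : (al * p = Q)%N. Proof. by rewrite /al -expnSr prednK. Qed.

Let Q_gt0 : (0 < Q)%N. Proof. by rewrite expn_gt0 prime_gt0. Qed.

Let cardK2 : #|K| = (Q ^ 2)%N. Proof. by rewrite cardK /Q -expnM muln2. Qed.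

Let f00 : f0.[0] != 0.
Proof.
apply: horner0_prod_XaddC_neq0 => v; rewrite fmorph_eq0.
by apply: contraTneq => ->.
Qed.

Let size_f0 : size f0 = (size vs).+1.
Proof. exact: size_prod_XaddC. Qed.

Let f0_neq0 : f0 != 0.
Proof. by rewrite -size_poly_gt0 size_f0. Qed.

Let size_f : size f = (size vs).+2.
Proof. by rewrite /f mulrC size_mulX // size_f0. Qed.

Let fE : f = \prod_(v <- 0 :: vs) ('X - (- iota v)%:P).
Proof.
rewrite big_cons rmorph0 oppr0 subr0; congr (_ * _).
by apply: eq_bigr => v _; rewrite polyCN opprK.
Qed.

Let expr_sum t n (w : nat -> K) :
  (\sum_(i < n) w i) ^+ (p ^ t) = \sum_(i < n) w i ^+ (p ^ t).
Proof.
have pt0 : (0 < p ^ t)%N by rewrite expn_gt0 prime_gt0.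
apply: (big_morph (fun y => y ^+ (p ^ t))) => [x y|]; last by rewrite expr0n gtn_eqF.
by rewrite (exprDn_pchar _ _ (pnat_pchar_Fp t pp iota)).
Qed.

Let trace_descends x : exists y, iota y = \sum_(t < a.*2) u x ^+ (p ^ t).
Proof.
apply: frob_fixed; rewrite /= card_Fp //.
have := expr_sum 1 a.*2 (fun t => u x ^+ (p ^ t)); rewrite expn1 => ->.
rewrite (eq_bigr (fun t : 'I_a.*2 => u x ^+ (p ^ t.+1))) => [|t _]; last first.
  by rewrite -exprM -expnSr.
apply: (addrI (u x)); transitivity (\sum_(t < a.*2.+1) u x ^+ (p ^ t)).
  by rewrite big_ord_recl /= expn0 expr1.
by rewrite big_ord_recr /= addrC -cardK expf_card.
Qed.

(** Here [t x] is the trace of [u x]. The half trace h, the sum of u^(p^i) over i < a, satisfies h +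
    h^Q = y on the fiber over y. With V = hE this reads (E^Q : V^Q) = (E : yE - V), with factor
    E^(Q-1). *)
Lemma extension_sum_add (Qbig : (p * (size vs).+1 + 4 < Q)%N) :
  exists2 g : K -> algC,
    (forall P x, P \is monic ->
       map_poly iota P = \prod_(t < a.*2) ('X - (x ^+ (p ^ t))%:P) -> L P = g x) &
    `|\sum_x g x| <= ((p * (2 * (p * (size vs).+1) + 4)).+1 + (size vs).+1)%:R * Q%:R.
Proof.
have /fin_all_exists[t tE] := trace_descends.
exists (fun x => if f.[x] != 0 then psi (t x) else 0) => [P x Pm PE|].
  have PN v : iota P.[- v] = \prod_(t < a.*2) - (x + iota v) ^+ (p ^ t).
    rewrite -horner_map /= PE rmorphN horner_prod; apply: eq_bigr => i _.
    by rewrite !hornerE exprD_iota // opprD addrC.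
  have PN0 v : (P.[- v] == 0) = (x + iota v == 0).
    rewrite -(fmorph_eq0 iota) PN prodrN mulf_eq0 signr_eq0 /=.
    apply/prodf_eq0/idP => [[i _]|/eqP xv]; first by rewrite expf_eq0 => /andP[].
    have a2 : (0 < a.*2)%N by rewrite double_gt0.
    by exists (Ordinal a2) => //; rewrite expr1 xv.
  have -> : (f.[x] != 0) = good P.
    rewrite fE horner_prod prodf_seq_neq0; apply: eq_all => v.
    by rewrite !hornerE opprK PN0.
  rewrite /L; case: ifP => // gP; congr psi; apply: (fmorph_inj iota).
  have fx0 : f.[x] != 0.
    rewrite fE horner_prod prodf_seq_neq0; apply/allP => v /(allP gP).
    by rewrite !hornerE opprK PN0.
  rewrite tE rmorph_sum /u fE logderiv_prod_XsubC -?fE //=.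
  transitivity (\sum_(v <- 0 :: vs) \sum_(t < a.*2) (x - - iota v)^-1 ^+ (p ^ t)).
    rewrite big_seq [RHS]big_seq; apply: eq_bigr => v /(allP gP) /= Pv.
    have iPv : (map_poly iota P).[- iota v] != 0 by rewrite -rmorphN horner_map fmorph_eq0.
    rewrite rmorphN fmorph_div -!horner_map /= rmorphN -deriv_map.
    move: iPv; rewrite PE => iPv; rewrite logderiv_prod_XsubC // -sumrN.
    by apply: eq_bigr => i _; rewrite opprK -invrN opprB opprK exprVn exprD_iota.
  rewrite exchange_big; apply: eq_bigr => i _ /=.
  have pt0 : (0 < p ^ i)%N by rewrite expn_gt0 prime_gt0.
  rewrite (big_morph (fun y => y ^+ (p ^ i)) (id1 := 0) (op1 := +%R)) // => [y z|].
    by rewrite (exprDn_pchar _ _ (pnat_pchar_Fp i pp iota)).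
  by rewrite expr0n gtn_eqF.
pose G := [set x | f.[x] != 0]; pose M := p; pose b := (size vs).+1.
pose C := (M * (2 * (M * b) + 4)).+1.
have -> : \sum_x (if f.[x] != 0 then psi (t x) else 0) = \sum_(x in G) psi (t x).
  by rewrite -big_mkcond; apply: eq_bigl => x; rewrite inE.
have cY : #|[set: F]| = M by rewrite cardsT card_Fp.
have f_nz : f != 0 by rewrite -size_poly_gt0 size_f.
have cG : (Q ^ 2 <= #|G| + b)%N.
  rewrite -cardK2 -(cardsC G) leq_add2l -ltnS -size_f cardE.
  apply: max_poly_roots => //; last exact: enum_uniq.
  by apply/allP => x; rewrite mem_enum !inE negbK.
apply: le_trans (@fiber_sum_le _ _ G [set: F] t psi (Q ^ 2 + C * Q) _ _ _ _ _) _ => //.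
- by rewrite -[RHS]sum_add_char_eq0; apply: eq_bigl => y; rewrite inE.
- by rewrite cY prime_gt0.
- move=> y _; rewrite cY.
  (* [al] is the largest p^i with i < a, so [E] clears all denominators in the half trace of [u] and
     [V] is a polynomial. *)
  pose E := f ^+ al; pose V := \sum_(i < a) f^`() ^+ (p ^ i) * f ^+ (al - p ^ i).
  have ial (i : 'I_a) : (p ^ i <= al)%N.
    by rewrite leq_exp2l ?prime_gt1 // -ltnS prednK.
  have alb : (al * b <= b * Q)%N.
    by rewrite mulnC leq_mul2l -alM leq_pmulr ?orbT ?prime_gt0.
  have sE : (size E <= (b * Q).+1)%N.
    apply: (leq_trans (size_exp_leS al (_ : size f <= b.+1)%N)); first by rewrite size_f.
    by rewrite ltnS.
  have sV : (size V <= (b * Q).+1)%N.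
    apply: (leq_trans (size_sum _ _ _)); apply/bigmax_leqP => i _.
    apply: (leq_trans (size_mul_leS (size_exp_leS (p ^ i) (_ : size f^`() <= b.+1)%N)
                            (size_exp_leS (al - p ^ i) (_ : size f <= b.+1)%N))).
    + by rewrite ltnW // -size_f lt_size_deriv.
    + by rewrite size_f.
    by rewrite -mulnDl subnKC // ltnS.
  apply: (@stepanov K Q M b al E (f0 ^+ al) V E ((iota y) *: E - V)) => //.
  + exact: prime_gt0.
  + by rewrite alM.
  + by rewrite alM.
  + by rewrite /E /f exprMn.
  + by rewrite horner_exp expf_neq0.
  (* At 0 the terms with i < a - 1 keep a positive power of [f] and vanish; the last one is the
     power [al] of f'(0) = f0(0), which is nonzero. *)
  + have a1 : (a.-1 < a)%N by rewrite prednK.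
    rewrite /V horner_sum (bigD1 (Ordinal a1)) //= subnn mulr1 big1 ?addr0 => [|i ia].
      rewrite horner_exp expf_neq0 // /f derivM derivX mul1r hornerD hornerM hornerX.
      by rewrite mul0r addr0.
    have ltia : (p ^ i < al)%N.
      rewrite ltn_exp2l ?prime_gt1 // ltn_neqAle -[X in _ && X]ltnS prednK // ltn_ord andbT.
      by [].
    by rewrite hornerM !horner_exp /f hornerM hornerX mul0r expr0n subn_eq0 leqNgt ltia mulr0.
  + rewrite (leq_trans (size_polyD _ _)) // geq_max size_polyN sV andbT.
    by rewrite (leq_trans (size_scale_leq _ _)).
  move=> x; rewrite !inE => /andP[fx /eqP txy]; exists (E.[x] ^+ Q.-1).
  have Ex : E.[x] != 0 by rewrite horner_exp expf_neq0.
  split; first by rewrite -exprSr prednK.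
  pose h := \sum_(i < a) u x ^+ (p ^ i).
  have Vx : V.[x] = h * E.[x].
    rewrite /V horner_sum /h mulr_suml; apply: eq_bigr => i _.
    rewrite hornerM !horner_exp /u expr_div_n -mulrA; congr (_ * _).
    by rewrite -[in RHS](subnKC (ial i)) exprD mulKf // expf_neq0.
  have hQ : h ^+ Q = iota y - h.
    rewrite -txy tE -addnn big_split_ord /= -/h [h + _]addrC addrK.
    rewrite (expr_sum a a (fun i => u x ^+ (p ^ i))).
    by apply: eq_bigr => i _; rewrite -exprM -expnD addnC.
  rewrite hornerD hornerN hornerZ Vx exprMn hQ -[in LHS](prednK Q_gt0) exprS; ring.
rewrite -natrM ler_nat leq_subLR mulnDl addnA -[(Q ^ 2 + _)%N]addnC -/C.
have bQ : (b <= b * Q)%N by rewrite leq_pmulr.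
by move: cG bQ; rewrite -/b; move: (C * Q)%N (b * Q)%N (Q ^ 2)%N => u1 v w; lia.
Qed.

End Extension.

Lemma weil_add (theta := fun x => if x == 0 then 0 else psi x^-1) :
  `|\sum_x theta x * \prod_(v <- vs) theta (x + v)| <=
   (2 * size (undup vs)).+2%:R * sqrtC p%:R.
Proof.
have -> : \sum_x theta x * \prod_(v <- vs) theta (x + v) = \sum_x L ('X - x%:P).
  apply: eq_bigr => x _; rewrite -[x in theta x]addr0 -(big_cons _ _ 0 vs xpredT).
  rewrite /L /good derivB derivX derivC subr0.
  have -> : all (fun v => ('X - x%:P).[- v] != 0) (0 :: vs) =
            all (fun v => x + v != 0) (0 :: vs).
    by apply: eq_all => v; rewrite !hornerE -opprD oppr_eq0 addrC.
  case: ifP => [/allP xv|/allPn[v vv]]; last first.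
    by rewrite negbK => /eqP xv0; rewrite (big_rem v) //= /theta xv0 eqxx mul0r.
  rewrite (big_morph psi psiD psi0) big_seq [RHS]big_seq; apply: eq_bigr => v /xv.
  rewrite /theta => /negPf->; congr psi.
  by rewrite !hornerE -opprD invrN opprK addrC.
apply: (sum_linear_le pp L1 LM monsumL (a0 := p * (size vs).+1 + 4)).
move=> a K iota a0a a_gt0 cK.
apply: extension_sum_add => //.
by apply: leq_ltn_trans a0a _; rewrite ltn_expl // prime_gt1.
Qed.

End AdditiveWeil.

(** * Moments and bilinear sums *)

Section Moments.

Variables (F : finFieldType) (theta : F -> algC) (e : nat) (B : algC).
Hypothesis theta_le1 : forall x, `|theta x| <= 1.
Hypothesis theta_conj : forall x, (theta x)^* = theta x ^+ e.
Hypothesis weil : forall vs, 0 \notin vs ->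
  `|\sum_x theta x * \prod_(v <- vs) theta (x + v)| <= (2 * size (undup vs)).+2%:R * B.
Hypothesis B_ge0 : 0 <= B.

(* Conjugates of theta are powers of theta, so mixed products are covered by
   lists [vs] with repetitions, and only their distinct elements cost. *)
Lemma weil_tuple n (f : 'I_n -> F) (eps : 'I_n -> nat) i0 :
    eps i0 = 1%N -> (forall i, i != i0 -> f i != f i0) ->
  `|\sum_x \prod_i theta (x + f i) ^+ eps i| <= (2 * n).+2%:R * B.
Proof.
move=> ei0 fi0.
pose vs := flatten [seq nseq (eps i) (f i - f i0) | i <- enum (predC1 i0)].
have vs0 : 0 \notin vs.
  apply/flatten_mapP => -[i]; rewrite mem_enum inE => ii0.
  by rewrite mem_nseq eq_sym subr_eq0 (negPf (fi0 i ii0)) andbF.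
have -> : \sum_x \prod_i theta (x + f i) ^+ eps i =
          \sum_x theta x * \prod_(v <- vs) theta (x + v).
  rewrite (reindex_inj (addIr (- f i0))) /=; apply: eq_bigr => x _.
  rewrite (bigD1 i0) //= ei0 subrK expr1; congr (_ * _).
  rewrite big_flatten big_map big_enum /=; apply: eq_bigr => i _.
  by rewrite big_nseq iter_mulr_1 addrAC -addrA.
apply: le_trans (weil vs0) _; rewrite ler_wpM2r // ler_nat !ltnS leq_mul2l /=.
rewrite -[X in (_ <= X)%N]card_ord -(size_image (fun i => f i - f i0)).
apply: uniq_leq_size; first exact: undup_uniq.
move=> v; rewrite mem_undup => /flatten_mapP[i _]; rewrite mem_nseq => /andP[_ /eqP->].
by apply/mapP; exists i; rewrite ?mem_enum.
Qed.

(** A value attained once gives a factor [theta], or its conjugate, that no other factor can cancel: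
    this is the case covered by the Weil bound. *)
Definition singly_attained n (f : {ffun 'I_n -> F}) :=
  [exists i0, [forall i, (i != i0) ==> (f i != f i0)]].

(** If every value is attained at least twice, there are at most [r] values, so [f] factors through
    'I_r: [r ^ (r + r)] choices for the first map and [#|V| ^ r] for the second. *)
Lemma card_nowhere_single (V : {set F}) r : (0 < r)%N ->
  (#|[set f : {ffun 'I_(r + r) -> F} | (f \in ffun_on (mem V)) && ~~ singly_attained f]|
   <= r ^ (r + r) * #|V| ^ r)%N.
Proof.
case: r => // r _; set n := (r.+1 + r.+1)%N.
pose comp (gh : {ffun 'I_r.+1 -> F} * {ffun 'I_n -> 'I_r.+1}) := [ffun i => gh.1 (gh.2 i)].
set bad := [set _ | _]; pose D := setX [set g : {ffun 'I_r.+1 -> F} | g \in ffun_on (mem V)]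
  [set: {ffun 'I_n -> 'I_r.+1}].
have cD : #|D| = (r.+1 ^ n * #|V| ^ r.+1)%N.
  by rewrite cardsX cardsT card_ffun !card_ord cardsE card_ffun_on card_ord mulnC.
rewrite -cD; apply: leq_trans (leq_imset_card comp _); apply: subset_leq_card.
apply/subsetP => f; rewrite inE => /andP[/ffun_onP fV nf].
pose im := f @: [set: 'I_n].
have cim : (#|im| <= r.+1)%N.
  rewrite -(leq_pmul2r (isT : 0 < 2)%N) [X in (_ <= X)%N]muln2 -addnn -/n -sum_nat_const.
  rewrite -[X in (_ <= X)%N]card_ord -sum1_card (partition_big f (mem im)) /=; last first.
    by move=> i _; rewrite imset_f.
  apply: leq_sum => y /imsetP[i _ ->].
  move: nf; rewrite negb_exists => /forallP/(_ i); rewrite negb_forall => /existsP[j].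
  rewrite negb_imply negbK => /andP[ji /eqP fji].
  by rewrite (bigD1 i) //= (bigD1 j) ?fji ?eqxx //= add1n addn1.
apply/imsetP; pose g : {ffun 'I_r.+1 -> F} := [ffun k : 'I_r.+1 => nth (f ord0) (enum im) k].
pose h : {ffun 'I_n -> 'I_r.+1} := [ffun i => inord (index (f i) (enum im))].
exists (g, h); last first.
  have fi i : f i \in enum im by rewrite mem_enum imset_f.
  apply/ffunP => i; rewrite !ffunE inordK ?nth_index //.
  by rewrite (leq_trans _ cim) // cardE index_mem.
rewrite !inE andbT; apply/ffun_onP => k; rewrite ffunE.
have [ks|ks] := ltnP k (size (enum im)); last by rewrite nth_default.
by have := mem_nth (f ord0) ks; rewrite mem_enum => /imsetP[i _ ->].
Qed.

Lemma moment_bound (V : {set F}) r : (0 < r)%N ->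
  \sum_x `|\sum_(v in V) theta (x + v)| ^+ (r + r) <=
    (r ^ (r + r) * #|V| ^ r * #|F|)%:R + (#|V| ^ (r + r) * (2 * (r + r)).+2)%:R * B.
Proof.
move=> r0; set n := (r + r)%N; pose Z x := \sum_(v in V) theta (x + v).
(* |Z|^(2r) is Z^r times its conjugate: the first [r] coordinates carry [theta], the last [r] its
   conjugate [theta ^+ e]. *)
pose eps (i : 'I_n) := if (i < r)%N then 1%N else e.
pose eps' (i : 'I_n) := if (i < r)%N then e else 1%N.
pose c (f : {ffun 'I_n -> F}) := \sum_x \prod_i theta (x + f i) ^+ eps i.
have conj_sum x : (Z x)^* = \sum_(v in V) theta (x + v) ^+ e.
  by rewrite /Z rmorph_sum; apply: eq_bigr => v _; rewrite /= theta_conj.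
have ZE : \sum_x `|Z x| ^+ n = \sum_(f in ffun_on (mem V)) c f.
  rewrite [RHS]exchange_big; apply: eq_bigr => x _ /=.
  rewrite -(bigA_distr_big _ (fun i v => theta (x + v) ^+ eps i)).
  rewrite /n big_split_ord /= /eps.
  rewrite (eq_bigr (fun=> Z x)) => [|i _]; last first.
    by apply: eq_bigr => v _; rewrite /= ltn_ord expr1.
  rewrite [X in _ * X](eq_bigr (fun=> (Z x)^*)) => [|i _]; last first.
    by rewrite conj_sum; apply: eq_bigr => v _; rewrite /= ltnNge leq_addr.
  by rewrite !prodr_const !card_ord -exprMn -normCK -exprM mul2n addnn.
rewrite -[leLHS]ger0_norm ?sumr_ge0 // => [|x _]; last by rewrite exprn_ge0.
rewrite ZE; apply: le_trans (ler_norm_sum _ _ _) _.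
rewrite (bigID (@singly_attained n)) /= addrC; apply: lerD.
  apply: (@le_trans _ _ (\sum_(f in ffun_on (mem V) | ~~ singly_attained f) #|F|%:R)).
    apply: ler_sum => f _; apply: le_trans (ler_norm_sum _ _ _) _.
    apply: (@le_trans _ _ (\sum_(x : F) 1)); last by rewrite sumr_const.
    apply: ler_sum => x _; rewrite normr_prod prodr_ile1 // => i _.
    by rewrite normrX exprn_ge0 //= exprn_ile1.
  rewrite big_const iter_addr_0 -[_ *+ _]mulr_natl -natrM ler_nat leq_mul2r; apply/orP; right.
  apply: leq_trans (card_nowhere_single V r0); apply/eq_leq/eq_card => f.
  by rewrite !inE.
apply: (@le_trans _ _ (\sum_(f in ffun_on (mem V) | singly_attained f)
   ((2 * n).+2%:R * B))).
  apply: ler_sum => f /andP[_ /existsP[i0 /forallP fi0]].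
  have {}fi0 i : i != i0 -> f i != f i0 by move=> ii0; have /implyP := fi0 i; apply.
  have [i0r|ri0] := ltnP i0 r; first by apply: (weil_tuple (i0 := i0)); rewrite // /eps i0r.
  (* The index of the single value lies in the conjugated half; conjugating the whole sum exchanges
     the halves. *)
  rewrite -norm_conjC /c rmorph_sum /=.
  rewrite (eq_bigr (fun x => \prod_i theta (x + f i) ^+ eps' i)) => [|x _]; last first.
    rewrite rmorph_prod; apply: eq_bigr => i _; rewrite /= /eps /eps'.
    by case: ifP => _; rewrite expr1 -theta_conj ?conjCK.
  by apply: (weil_tuple (i0 := i0)); rewrite // /eps' ltnNge ri0.
rewrite big_const iter_addr_0 -[_ *+ _]mulr_natl natrM -mulrA ler_wpM2r //.
  by rewrite mulr_ge0.
rewrite ler_nat -[n in (_ <= _ ^ n)%N]card_ord -card_ffun_on; apply: subset_leq_card.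
by apply/subsetP => f; rewrite !inE => /andP[].
Qed.

End Moments.

(** Induction through Chebyshev's sum inequality for the equally ordered families [a i] and
    [a i ^+ m]. *)
Lemma power_mean (I : finType) (U : {set I}) (a : I -> algC) n :
  (forall i, i \in U -> 0 <= a i) ->
  (\sum_(i in U) a i) ^+ n.+1 <= #|U|%:R ^+ n * \sum_(i in U) a i ^+ n.+1.
Proof.
move=> a0; have chebyshev m : (\sum_(i in U) a i) * (\sum_(i in U) a i ^+ m) <=
    #|U|%:R * \sum_(i in U) a i ^+ m.+1.
  have pos i j : i \in U -> j \in U -> 0 <= (a i - a j) * (a i ^+ m - a j ^+ m).
    move=> iU jU; rewrite subrXX mulrA; apply: mulr_ge0.
      by rewrite -expr2 real_exprn_even_ge0 // rpredB // ger0_real // a0.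
    by apply: sumr_ge0 => k _; rewrite mulr_ge0 // exprn_ge0 // a0.
  have : 0 <= \sum_(i in U) \sum_(j in U) (a i - a j) * (a i ^+ m - a j ^+ m).
    by apply: sumr_ge0 => i iU; apply: sumr_ge0 => j jU; apply: pos.
  have -> : \sum_(i in U) \sum_(j in U) (a i - a j) * (a i ^+ m - a j ^+ m) =
    (#|U|%:R * (\sum_(i in U) a i ^+ m.+1) -
     (\sum_(i in U) a i) * (\sum_(i in U) a i ^+ m)) *+ 2.
    transitivity (\sum_(i in U) (#|U|%:R * a i ^+ m.+1 - a i * (\sum_(j in U) a j ^+ m)
       - (\sum_(j in U) a j) * a i ^+ m + \sum_(j in U) a j ^+ m.+1)).
      apply: eq_bigr => i _; rewrite mulr_natl -sumr_const mulr_sumr mulr_suml.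
      rewrite -!sumrB -big_split; apply: eq_bigr => j _ /=.
      by rewrite !exprS; ring.
    rewrite big_split !sumrB /= sumr_const -mulr_sumr -mulr_suml -mulr_sumr -mulr_natl.
    by ring.
  by rewrite pmulrn_lge0 // subr_ge0.
elim: n => [|n IHn]; first by rewrite expr0 mul1r.
have U0 : 0 <= #|U|%:R ^+ n :> algC by rewrite exprn_ge0.
rewrite exprS [X in _ <= X * _]exprSr -mulrA.
apply: (@le_trans _ _ (#|U|%:R ^+ n * ((\sum_(i in U) a i) * \sum_(i in U) a i ^+ n.+1))).
  by rewrite mulrCA ler_wpM2l // sumr_ge0.
by rewrite ler_wpM2l.
Qed.

(** The power mean inequality in [u] and extension of the sum from [U] to [F] lead to the moment.
    The lower bound on [#|V|] gives sqrt|F| <= |V|^r, so the diagonal term has the size of the Weil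
    term. *)
Lemma bilinear_bound (F : finFieldType) (theta : F -> algC) (e r : nat) (U V : {set F}) :
    (forall x, `|theta x| <= 1) -> (forall x, (theta x)^* = theta x ^+ e) ->
    (forall vs, 0 \notin vs -> `|\sum_x theta x * \prod_(v <- vs) theta (x + v)|
        <= (2 * size (undup vs)).+2%:R * sqrtC #|F|%:R) ->
    (0 < r)%N -> (#|F| <= #|V| ^ (r + r))%N ->
  `|\sum_(u in U) \sum_(v in V) theta (u + v)| ^+ (r + r) <=
    ((r ^ (r + r) + (2 * (r + r)).+2) * #|U| ^ (r + r).-1 * #|V| ^ (r + r))%:R
      * sqrtC #|F|%:R.
Proof.
move=> th1 thc weil r0 FV; pose B : algC := sqrtC #|F|%:R; set n := (r + r)%N.
have n0 : n = n.-1.+1 by rewrite prednK // addn_gt0 r0.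
have B0 : 0 <= B by rewrite sqrtC_ge0 ler0n.
have BB : B * B = #|F|%:R by rewrite -expr2 sqrtCK.
have VB : B <= (#|V| ^ r)%:R.
  rewrite -(@ler_pXn2r _ 2) ?nnegrE // sqrtCK -natrX ler_nat -expnM muln2 -addnn.
  exact: FV.
have := moment_bound th1 thc weil B0 V r0; rewrite -/n => mom.
have {}mom : \sum_x `|\sum_(v in V) theta (x + v)| ^+ n <=
    ((r ^ n + (2 * n).+2) * #|V| ^ n)%:R * B.
  apply: le_trans mom _.
  rewrite [X in _ <= X%:R * _]mulnDl [in leRHS]natrD [leRHS]mulrDl.
  rewrite [X in _ <= _ + X%:R * _]mulnC lerD2r.
  rewrite natrM -BB mulrA ler_wpM2r //.
  have -> : (#|V| ^ n = #|V| ^ r * #|V| ^ r)%N by rewrite -expnD.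
  by rewrite mulnA [leRHS]natrM ler_wpM2l.
apply: (@le_trans _ _ ((\sum_(u in U) `|\sum_(v in V) theta (u + v)|) ^+ n)).
  by rewrite lerXn2r ?nnegrE ?sumr_ge0 // ler_norm_sum.
rewrite n0; apply: le_trans (power_mean _ _) _ => //; rewrite -n0.
apply: (@le_trans _ _ (#|U|%:R ^+ n.-1 * (((r ^ n + (2 * n).+2) * #|V| ^ n)%:R * B))).
  rewrite ler_wpM2l ?exprn_ge0 //; apply: le_trans mom.
  rewrite [leRHS](bigID (mem U)) /= lerDl sumr_ge0 // => x _.
  by rewrite exprn_ge0.
by rewrite -natrX mulrA -natrM mulnCA mulnA.
Qed.

(** * Fourier analysis modulo [M] *)

Lemma prim_root_norm (z : algC) M : M.-primitive_root z -> `|z| = 1.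
Proof.
move=> zM; apply/eqP; rewrite -(@pexpr_eq1 _ _ M) ?(prim_order_gt0 zM) //.
by rewrite -normrX prim_expr_order // normr1.
Qed.

Lemma conj_unimodular (y : algC) : `|y| = 1 -> y^* = y^-1.
Proof. by move=> y1; rewrite [RHS]invC_norm y1 expr1n invr1 mul1r. Qed.

Lemma sum_powers_eq0 (y : algC) M : y ^+ M = 1 -> y != 1 -> \sum_(k < M) y ^+ k = 0.
Proof.
move=> yM y1; apply: (mulfI (_ : y - 1 != 0)); first by rewrite subr_eq0.
by rewrite -subrX1 yM subrr mulr0.
Qed.

(** Lagrange's identity. *)
Lemma cauchy_schwarz (I : finType) (a b : I -> algC) :
    (forall i, 0 <= a i) -> (forall i, 0 <= b i) ->
  (\sum_i a i * b i) ^+ 2 <= (\sum_i a i ^+ 2) * (\sum_i b i ^+ 2).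
Proof.
move=> a0 b0; have : 0 <= \sum_i \sum_j (a i * b j - a j * b i) ^+ 2.
  apply: sumr_ge0 => i _; apply: sumr_ge0 => j _.
  by rewrite real_exprn_even_ge0 // rpredB // ger0_real // mulr_ge0.
have -> : \sum_i \sum_j (a i * b j - a j * b i) ^+ 2 =
  ((\sum_i a i ^+ 2) * (\sum_i b i ^+ 2) - (\sum_i a i * b i) ^+ 2) *+ 2.
  transitivity (\sum_i (a i ^+ 2 * (\sum_j b j ^+ 2) + b i ^+ 2 * (\sum_j a j ^+ 2)
      - 2%:R * (a i * b i) * \sum_j (a j * b j))).
    apply: eq_bigr => i _; rewrite !mulr_sumr -big_split -sumrB.
    by apply: eq_bigr => j _ /=; ring.
  by rewrite sumrB big_split /= -!mulr_suml -mulr_sumr; ring.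
by rewrite pmulrn_lge0 // subr_ge0.
Qed.

Section Spectral.

Variables (F : finZmodType) (M : nat) (z : algC).
Hypothesis zM : M.-primitive_root z.

Let z1 : `|z| = 1. Proof. exact: prim_root_norm zM. Qed.

Let z0 : z != 0. Proof. by rewrite -normr_eq0 z1 oner_eq0. Qed.

Let zXM k : (z ^+ k) ^+ M = 1.
Proof. by rewrite exprAC (prim_expr_order zM) expr1n. Qed.

(** [lam] will be a discrete logarithm or the representative of a residue, so that multiplicative
    and additive characters are both treated as characters of Z/M. *)
Definition fourier (lam : F -> nat) (A : {set F}) (k : nat) : algC :=
  \sum_(a in A) z ^- (k * lam a).

Lemma parseval (lam : F -> nat) (A : {set F}) :
    {in A &, forall x y, lam x = lam y %[mod M] -> x = y} ->
  \sum_(k < M) `|fourier lam A k| ^+ 2 = (M * #|A|)%:R.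
Proof.
move=> lamI.
transitivity (\sum_(k < M) \sum_(a in A) \sum_(b in A) (z ^- lam a * z ^+ lam b) ^+ k).
  apply: eq_bigr => k _; rewrite normCK /fourier rmorph_sum mulr_suml.
  apply: eq_bigr => a _; rewrite mulr_sumr; apply: eq_bigr => b _ /=.
  rewrite fmorphV rmorphXn /= conj_unimodular // exprVn invrK.
  by rewrite exprMn exprVn ![(k * _)%N]mulnC !exprM.
rewrite exchange_big /= mulnC natrM mulr_natl -sumr_const.
apply: eq_bigr => a aA; rewrite exchange_big (bigD1 a) //=.
rewrite [X in _ + X]big1 ?addr0 => [|b /andP[bA ba]].
  rewrite (eq_bigr (fun=> 1)) ?sumr_const ?card_ord // => k _.
  by rewrite mulVf ?expr1n // expf_neq0.
apply: sum_powers_eq0.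
  by rewrite exprMn exprVn !zXM invr1 mulr1.
apply: contraNneq ba => zab; apply/eqP/lamI => //; apply/eqP.
rewrite -(eq_prim_root_expr zM); apply/eqP.
by rewrite -[RHS]mulr1 -zab mulrA divff ?mul1r // expf_neq0.
Qed.

(** Avoidance makes the character sum counting solutions vanish, so its term at k = 0 is balanced by
    the others. These are at most [W] times the sum of |A^(k)||B^(k)|, which Cauchy-Schwarz and
    Parseval bound by M (|A||B|)^(1/2). *)
Lemma avoiding_bound (l lamA lamB : F -> nat) (A B U V : {set F}) (W : algC) :
    {in A &, forall x y, lamA x = lamA y %[mod M] -> x = y} ->
    {in B &, forall x y, lamB x = lamB y %[mod M] -> x = y} ->
    (forall u v a b, u \in U -> v \in V -> a \in A -> b \in B -> u + v != 0 ->
       (l (u + v)%R <> lamA a + lamB b %[mod M])%N) ->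
    0 <= W ->
    (forall k, (0 < k < M)%N -> `|\sum_(u in U) \sum_(v in V)
       (if u + v == 0 then 0 else z ^+ (k * l (u + v)))| <= W) ->
    (0 < #|A|)%N -> (0 < #|B|)%N ->
  (\sum_(u in U) \sum_(v in V) (u + v != 0)%R)%N%:R ^+ 2 * (#|A| * #|B|)%:R
     <= W ^+ 2 * M%:R ^+ 2.
Proof.
move=> IA IB avoid W0 Wk A0 B0.
have M0 : (0 < M)%N := prim_order_gt0 zM.
pose T k := \sum_(u in U) \sum_(v in V) (if u + v == 0 then 0 else z ^+ (k * l (u + v))).
set n0 := (\sum_(u in U) _)%N.
have T0 : T 0 = n0%:R.
  rewrite /T /n0 natr_sum; apply: eq_bigr => u _; rewrite natr_sum; apply: eq_bigr => v _.
  by case: eqP => //; rewrite mul0n expr0.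
have tot : \sum_(k < M) T k * (fourier lamA A k * fourier lamB B k) = 0.
  rewrite /T; under eq_bigr do rewrite mulr_suml.
  rewrite exchange_big big1 // => u uU; under eq_bigr do rewrite mulr_suml.
  rewrite exchange_big big1 // => v vV.
  have [uv0|uv0] := eqVneq (u + v) 0.
    by rewrite big1 // => k _; rewrite mul0r.
  under eq_bigr do rewrite /fourier mulr_suml mulr_sumr.
  rewrite exchange_big big1 // => a aA; under eq_bigr do rewrite !mulr_sumr.
  rewrite exchange_big big1 // => b bB /=.
  rewrite (eq_bigr (fun k : 'I_M => (z ^+ l (u + v) / z ^+ (lamA a + lamB b)) ^+ k)).
    apply: sum_powers_eq0.
      by rewrite exprMn exprVn !zXM divr1.
    apply: contra_not_neq (avoid u v a b uU vV aA bB uv0) => zz; apply/eqP.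
    rewrite -(eq_prim_root_expr zM); apply/eqP.
    by rewrite -[RHS]mul1r -zz divfK // expf_neq0.
  move=> k _; rewrite exprMn exprVn -!exprM ![(_ * k)%N]mulnC mulnDr exprD invfM.
  by [].
have main : n0%:R * (#|A| * #|B|)%:R <=
    W * \sum_(k < M) `|fourier lamA A k| * `|fourier lamB B k|.
  have f0 lam C : fourier lam C 0 = #|C|%:R.
    by rewrite /fourier -sumr_const; apply: eq_bigr => a _; rewrite mul0n expr0 invr1.
  move: tot; rewrite (bigD1 (Ordinal M0)) //= T0 !f0 => /eqP.
  rewrite addr_eq0 => /eqP E; rewrite natrM -[leLHS]ger0_norm ?mulr_ge0 // E normrN.
  apply: le_trans (ler_norm_sum _ _ _) _; rewrite mulr_sumr.
  rewrite [leRHS](bigD1 (Ordinal M0)) //= -[leLHS]add0r lerD ?mulr_ge0 //.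
  apply: ler_sum => k k0; rewrite !normrM ler_wpM2r ?mulr_ge0 //.
  by apply: Wk; rewrite ltn_ord andbT lt0n.
have CS := cauchy_schwarz (fun k : 'I_M => normr_ge0 (fourier lamA A k))
                          (fun k : 'I_M => normr_ge0 (fourier lamB B k)).
rewrite !parseval // in CS; have AB0 : 0 < (#|A| * #|B|)%:R :> algC.
  by rewrite ltr0n muln_gt0 A0.
rewrite -(ler_pM2r AB0).
apply: (@le_trans _ _ ((n0%:R * (#|A| * #|B|)%:R) ^+ 2)); first by rewrite exprMn expr2 mulrA.
apply: (@le_trans _ _ ((W * \sum_(k < M) `|fourier lamA A k| * `|fourier lamB B k|) ^+ 2)).
  rewrite lerXn2r ?nnegrE ?mulr_ge0 // sumr_ge0 // => k _.
  by rewrite mulr_ge0.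
rewrite exprMn -[leRHS]mulrA ler_wpM2l ?exprn_ge0 //; apply: le_trans CS _.
by rewrite -natrX -!natrM ler_nat; apply/eq_leq; ring.
Qed.

End Spectral.

(** The first summand counts patterns of tuples without a single value; the second is the Weil
    constant for 2r shifts. *)
Definition moment_const r := (r ^ (r + r) + (2 * (r + r)).+2)%N.

(** Each [u] loses at most the one element v = -u, and |V| - 1 >= |V|/2. *)
Lemma card_sumset_neq0 (F : finZmodType) (U V : {set F}) : (1 < #|V|)%N ->
  (#|U| * #|V| <= 2 * \sum_(u in U) \sum_(v in V) (u + v != 0)%R)%N.
Proof.
move=> V1; rewrite -sum_nat_const big_distrr; apply: leq_sum => u _ /=.
have : (#|V| <= (\sum_(v in V) (u + v != 0)%R).+1)%N.
  rewrite -sum1_card (bigID (fun v => u + v == 0)) /= addnC -[X in (_ <= X)%N]addn1 leq_add //.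
    rewrite [leqRHS](bigID (fun v => u + v == 0)) /= -[leqLHS]add0n leq_add //.
    by apply: leq_sum => v /andP[_ ->].
  rewrite sum1_card -(card1 (- u)); apply: subset_leq_card; apply/subsetP => v.
  by rewrite unfold_in inE addrC addr_eq0 => /andP[_].
by move: V1; move: (#|V|) (\sum_(v in V) _)%N => x y; lia.
Qed.

(** After raising to the power 2r, the powers of |V| on both sides cancel and leave a bound on |U|
    alone; squaring removes sqrt p. *)
Lemma avoiding_cube_bound (p M : nat) (z : algC) (l lamA lamB : 'F_p -> nat)
    (A B U V : {set 'F_p}) r :
    prime p -> (1 < M <= p)%N -> M.-primitive_root z ->
    {in A &, forall x y, lamA x = lamA y %[mod M] -> x = y} ->
    {in B &, forall x y, lamB x = lamB y %[mod M] -> x = y} ->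
    (forall u v a b, u \in U -> v \in V -> a \in A -> b \in B -> u + v != 0 ->
       (l (u + v)%R <> lamA a + lamB b %[mod M])%N) ->
    (forall k, (0 < k < M)%N -> forall vs, 0 \notin vs ->
       let theta x := if x == 0 then 0 else z ^+ (k * l x) in
       `|\sum_x theta x * \prod_(v <- vs) theta (x + v)|
        <= (2 * size (undup vs)).+2%:R * sqrtC p%:R) ->
    (0 < r)%N -> (p <= #|V| ^ (r + r))%N -> (0 < #|U|)%N -> (0 < #|A|)%N -> (0 < #|B|)%N ->
  (#|U| ^ 2 * (#|A| * #|B|) ^ (r + r) <=
     (2 ^ (r + r) * moment_const r) ^ 2 * p ^ (r + r).*2.+1)%N.
Proof.
move=> pp /andP[M1 Mp] zM IA IB avoid weil r0 pV U0 A0 B0.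
set n := (r + r)%N; have n_gt0 : (0 < n)%N by rewrite addn_gt0 r0.
have p2 := prime_gt1 pp; have cF : #|'F_p| = p by rewrite card_Fp.
have V1 : (1 < #|V|)%N.
  have := leq_trans p2 pV; rewrite -/n; case: #|V| => [|[|//]].
    by rewrite exp0n.
  by rewrite exp1n.
pose S : algC := sqrtC p%:R; have S0 : 0 <= S by rewrite sqrtC_ge0 ler0n.
pose Bd := (moment_const r * #|U| ^ n.-1 * #|V| ^ n)%:R * S.
have Bd0 : 0 <= Bd by rewrite mulr_ge0.
pose W := n.-root Bd; have W0 : 0 <= W by rewrite rootC_ge0.
have z1 := prim_root_norm zM.
have Wk k : (0 < k < M)%N -> `|\sum_(u in U) \sum_(v in V)
       (if u + v == 0 then 0 else z ^+ (k * l (u + v)))| <= W.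
  move=> kM; rewrite -(ler_pXn2r n_gt0) ?nnegrE // rootCK //.
  pose theta x := if x == 0 then 0 else z ^+ (k * l x).
  have := @bilinear_bound 'F_p theta M.-1 r U V; rewrite cF; apply=> //.
  - by move=> x; rewrite /theta; case: eqP => _; rewrite ?normr0 ?normrX ?z1 ?expr1n ?ler01.
  - move=> x; rewrite /theta; case: eqP => _.
      (* [1 < M] makes the exponent [M.-1] positive, so the power also vanishes where [theta]
         does. *)
      by rewrite conjC0 expr0n; case: (M) M1 => [|[|]].
    rewrite conj_unimodular ?normrX ?z1 ?expr1n //.
    have y0 : z ^+ (k * l x) != 0 by rewrite expf_neq0 // -normr_eq0 z1 oner_eq0.
    apply: (mulfI y0); rewrite divff // -exprS prednK 1?ltnW //.
    by rewrite exprAC (prim_expr_order zM) expr1n.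
  - by move=> vs /(weil k kM).
have := avoiding_bound zM IA IB avoid W0 Wk A0 B0.
have := card_sumset_neq0 U V1; set n0 := (\sum_(u in U) _)%N => UV n0W.
have n0Wr : n0%:R ^+ n * (#|A| * #|B|)%:R ^+ r <= Bd * p%:R ^+ n.
  rewrite -(rootCK n_gt0 Bd) -/W /n addnn -mul2n !exprM -!exprMn.
  rewrite lerXn2r ?nnegrE ?mulr_ge0 ?exprn_ge0 //.
  apply: le_trans n0W _; rewrite exprMn ler_wpM2l ?exprn_ge0 //.
  by rewrite lerXn2r ?nnegrE // ler_nat.
have key : #|U|%:R * (#|A| * #|B|)%:R ^+ r <= (2 ^ n * moment_const r)%:R * S * p%:R ^+ n.
  have UV0 : 0 < (#|U| ^ n.-1 * #|V| ^ n)%:R :> algC.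
    by rewrite ltr0n muln_gt0 !expn_gt0 U0 (ltnW V1).
  rewrite -(ler_pM2l UV0).
  have -> : (#|U| ^ n.-1 * #|V| ^ n)%:R * (#|U|%:R * (#|A| * #|B|)%:R ^+ r) =
            (#|U| * #|V|)%:R ^+ n * (#|A| * #|B|)%:R ^+ r :> algC.
    by rewrite mulrA -natrM -[in RHS]natrX mulnAC -expnSr prednK // expnMn.
  apply: (@le_trans _ _ ((2 * n0)%:R ^+ n * (#|A| * #|B|)%:R ^+ r)).
    by rewrite ler_wpM2r ?exprn_ge0 // lerXn2r ?nnegrE // ler_nat.
  rewrite natrM exprMn -[leLHS]mulrA.
  apply: (@le_trans _ _ (2%:R ^+ n * (Bd * p%:R ^+ n))); first by rewrite ler_wpM2l ?exprn_ge0.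
  by rewrite /Bd !natrM !natrX le_eqVlt; apply/orP; left; apply/eqP; ring.
have : (#|U|%:R * (#|A| * #|B|)%:R ^+ r) ^+ 2 <=
       ((2 ^ n * moment_const r)%:R * S * p%:R ^+ n) ^+ 2.
  by rewrite lerXn2r ?nnegrE ?mulr_ge0 ?exprn_ge0.
have SS : S ^+ 2 = p%:R by rewrite sqrtCK.
rewrite !exprMn SS -!exprM -!natrX -!natrM ler_nat !muln2 -addnn -/n.
by rewrite -mulnA -expnS.
Qed.

(** * Hilbert cubes *)

Lemma hilbert_cube0 (G : finZmodType) (a0 : G) (a : 'I_0 -> G) :
  hilbert_cube a0 a = [set a0].
Proof.
apply/setP => x; rewrite inE; apply/imsetP/eqP => [[eps _ ->]|->].
  by rewrite big_ord0 addr0.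
by exists [ffun=> false]; rewrite ?big_ord0 ?addr0.
Qed.

Lemma hilbert_cubeS (G : finZmodType) d (a0 : G) (a : 'I_d.+1 -> G)
    (H := hilbert_cube a0 (fun i => a (widen_ord (leqnSn d) i))) :
  hilbert_cube a0 a = H :|: [set a ord_max + x | x in H].
Proof.
apply/setP => x; apply/imsetP/setUP => [[eps _ ->]|[/imsetP[eps _ ->]|]].
- pose eps' := [ffun i : 'I_d => eps (widen_ord (leqnSn d) i)].
  have inH : a0 + \sum_(i < d) a (widen_ord (leqnSn d) i) *+ eps (widen_ord (leqnSn d) i) \in H.
    by apply/imsetP; exists eps' => //; congr (_ + _); apply: eq_bigr => i _; rewrite ffunE.
  rewrite big_ord_recr /=; case: (eps ord_max); last by left; rewrite addr0.
  by right; apply/imsetP; eexists; first exact: inH; rewrite addrA addrC.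
- exists [ffun i : 'I_d.+1 => oapp eps false (insub (i : nat))] => //.
  rewrite big_ord_recr /= ffunE insubF ?ltnn //= addr0; congr (_ + _).
  by apply: eq_bigr => i _; rewrite ffunE /= valK.
- move=> /imsetP[_ /imsetP[eps _ ->] ->].
  exists [ffun i : 'I_d.+1 => oapp eps true (insub (i : nat))] => //.
  rewrite big_ord_recr /= ffunE insubF ?ltnn //= [RHS]addrA [RHS]addrC; congr (_ + (_ + _)).
  by apply: eq_bigr => i _; rewrite ffunE /= valK.
Qed.

(** Generators are dropped from the end while the remaining cube stays large enough. The cube [W]
    where this stops is at most twice its predecessor, whose n-th power is below [p]; [U] collects
    the subset sums of the dropped generators. *)
Lemma hilbert_cube_split (G : finZmodType) d (a0 : G) (a : 'I_d -> G) n p :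
    (1 < p)%N -> (p <= #|hilbert_cube a0 a| ^ n)%N ->
  exists U W : {set G}, [/\ hilbert_cube a0 a = [set u + w | u in U, w in W],
    (p <= #|W| ^ n)%N & (#|W| ^ n <= 2 ^ n * p)%N].
Proof.
move=> p1; elim: d a => [|d IHd] a pH.
  by move: pH; rewrite hilbert_cube0 cards1 exp1n leqNgt p1.
pose a' i := a (widen_ord (leqnSn d) i).
have [pH'|H'p] := leqP p (#|hilbert_cube a0 a'| ^ n).
  have [U [W [HUW pW Wp]]] := IHd a' pH'.
  exists (U :|: [set a ord_max + u | u in U]), W; split=> //.
  rewrite hilbert_cubeS -/a' HUW; apply/setP => x; apply/setUP/imset2P.
    case=> [/imset2P[u w uU wW ->]|/imsetP[_ /imset2P[u w uU wW ->] ->]].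
      by exists u w; rewrite // inE uU.
    by exists (a ord_max + u) w; rewrite ?addrA // inE imset_f ?orbT.
  case=> u w /setUP[uU|/imsetP[u' uU ->]] wW ->; first by left; apply: imset2_f.
  by right; rewrite -addrA imset_f // imset2_f.
exists [set 0], (hilbert_cube a0 a); split=> //.
  apply/setP => x; apply/idP/imset2P => [xH|[_ w /set1P-> wH ->]]; last by rewrite add0r.
  by exists 0 x; rewrite ?inE ?add0r.
apply: (@leq_trans ((2 * #|hilbert_cube a0 a'|) ^ n)%N).
  have n0 : (0 < n)%N by case: n pH {IHd H'p} => //; rewrite expn0 leqNgt p1.
  rewrite leq_exp2r // hilbert_cubeS mul2n -addnn (leq_trans (leq_card_setU _ _)) //.
  by rewrite leq_add2l leq_imset_card.
by rewrite expnMn leq_mul2l ltnW ?orbT.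
Qed.

(** * The two avoidance problems and the final bound *)

Lemma exists_discrete_log (p : nat) : prime p -> exists (g : 'F_p) (l : 'F_p -> nat),
  p.-1.-primitive_root g /\ forall x, x != 0 -> x = g ^+ l x.
Proof.
move=> pp; have cF := card_Fp pp.
have p1_gt0 : (0 < p.-1)%N by rewrite -subn1 subn_gt0 prime_gt1.
have unity (x : 'F_p) : x != 0 -> x ^+ p.-1 = 1.
  move=> x0; apply: (mulfI x0); rewrite mulr1 -exprS prednK ?prime_gt0 //.
  by rewrite -[X in x ^+ X]cF expf_card.
have /hasP[g _ gP] : has (p.-1).-primitive_root (enum [set~ (0 : 'F_p)]).
  apply: has_prim_root => //; last by rewrite -cardE cardsC1 cF.
    apply/allP => x; rewrite mem_enum !inE => /unity x1.
    by rewrite unity_rootE x1.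
  exact: enum_uniq.
have /fin_all_exists[l lP] (x : 'F_p) : exists i : nat, x != 0 -> x = g ^+ i.
  have [->|/unity/(prim_rootP gP)[i ->]] := eqVneq x 0; first by exists 0%N.
  by exists i.
by exists g, l.
Qed.

(** A discrete logarithm turns u + v = ab into a sum modulo M = p - 1; [2 < p] provides nontrivial
    characters. *)
Lemma product_avoiding_bound (p : nat) (A B U V : {set 'F_p}) r :
    prime p -> (2 < p)%N -> 0 \notin A -> 0 \notin B ->
    (forall u v, u \in U -> v \in V -> u + v \notin prod_set A B) ->
    (0 < r)%N -> (p <= #|V| ^ (r + r))%N -> (0 < #|U|)%N -> (0 < #|A|)%N -> (0 < #|B|)%N ->
  (#|U| ^ 2 * (#|A| * #|B|) ^ (r + r) <=
     (2 ^ (r + r) * moment_const r) ^ 2 * p ^ (r + r).*2.+1)%N.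
Proof.
move=> pp p2 A0 B0 avoid r0 pV U0 cA cB.
have p1_gt1 : (1 < p.-1)%N by rewrite -subn1 ltn_subRL.
have [g [l [gP lP]]] := exists_discrete_log pp.
have [z zP] := C_prim_root_exists (ltnW p1_gt1).
have z1 := prim_root_norm zP.
have l_inj (S : {set 'F_p}) : 0 \notin S -> {in S &, forall x y, l x = l y %[mod p.-1] -> x = y}.
  move=> S0 x y xS yS /eqP; rewrite -(eq_prim_root_expr gP) => /eqP.
  by rewrite -!lP //; apply: contraNneq S0 => <-.
have lM x y : x != 0 -> y != 0 -> l (x * y) = l x + l y %[mod p.-1].
  move=> x0 y0; apply/eqP; rewrite -(eq_prim_root_expr gP) exprD -!lP //.
  by rewrite mulf_neq0.
apply: (@avoiding_cube_bound p p.-1 z l l l A B U V r pp _ zP) => //.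
- by rewrite p1_gt1 leq_pred.
- exact: l_inj.
- exact: l_inj.
- move=> u v a b uU vV aA bB uv0 luv.
  have a0 : a != 0 by apply: contraNneq A0 => <-.
  have b0 : b != 0 by apply: contraNneq B0 => <-.
  have /negP := avoid u v uU vV; apply; apply/imset2P; exists a b => //.
  rewrite (lP _ uv0) (lP a a0) (lP b b0) -exprD.
  by apply/eqP; rewrite (eq_prim_root_expr gP) luv.
move=> k /andP[k0 kM] vs vs0 /=.
apply: (@le_trans _ _ ((size (undup vs)).+1%:R * sqrtC p%:R)); last first.
  by rewrite ler_wpM2r ?sqrtC_ge0 // ler_nat ltnS mul2n -addnn -addnS leq_addr.
apply: (@weil_mult p pp (fun x => if x == 0 then 0 else z ^+ (k * l x))) => //.
- rewrite oner_eq0; have /eqP := lP 1 (oner_neq0 _); rewrite -[eqbLHS](expr0 g).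
  rewrite (eq_prim_root_expr gP) => /eqP l1; apply/eqP.
  rewrite mulnC exprM [X in X ^+ _ == _](_ : _ = 1) ?expr1n //.
  by apply/eqP; rewrite -[eqbRHS](expr0 z) (eq_prim_root_expr zP) l1.
- move=> x y; rewrite mulf_eq0; case: eqVneq => [_|x0] /=; first by rewrite mul0r.
  case: eqVneq => [_|y0] /=; first by rewrite mulr0.
  rewrite -exprD -mulnDr ![(k * _)%N]mulnC !exprM; congr (_ ^+ _).
  by apply/eqP; rewrite (eq_prim_root_expr zP) lM.
- have g0 : g != 0.
    apply/eqP => g0; have := prim_expr_order gP; rewrite g0 expr0n gtn_eqF ?(ltnW p1_gt1) //.
  exists g => //; rewrite (negPf g0) -[X in _ != X](expr0 z) mulnC exprM.
  have -> : z ^+ l g = z.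
    apply/eqP; rewrite -[eqbRHS]expr1 (eq_prim_root_expr zP) -(eq_prim_root_expr gP).
    by rewrite expr1 -lP.
  by rewrite (eq_prim_root_expr zP) mod0n modn_small // -lt0n.
- by move=> y; case: eqP => _; rewrite ?normr0 ?ler01 // normrX z1 expr1n.
Qed.

(** Inverting turns the avoided relation into 1/(u + v) = a + b, a sum modulo M = p, and the
    character argument into that of [weil_add]. *)
Lemma inv_sum_avoiding_bound (p : nat) (A B U V : {set 'F_p}) r :
    prime p ->
    (forall u v, u \in U -> v \in V -> u + v \notin inv_sum_set A B) ->
    (0 < r)%N -> (p <= #|V| ^ (r + r))%N -> (0 < #|U|)%N -> (0 < #|A|)%N -> (0 < #|B|)%N ->
  (#|U| ^ 2 * (#|A| * #|B|) ^ (r + r) <=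
     (2 ^ (r + r) * moment_const r) ^ 2 * p ^ (r + r).*2.+1)%N.
Proof.
move=> pp avoid r0 pV U0 cA cB.
have p_gt0 := prime_gt0 pp; have p_gt1 := prime_gt1 pp.
have [z zP] := C_prim_root_exists p_gt0.
have z1 := prim_root_norm zP.
pose lam (x : 'F_p) : nat := x.
have lam_lt x : (lam x < p)%N by rewrite -[X in (_ < X)%N](Fp_cast pp) ltn_ord.
have lamI x y : lam x = lam y %[mod p] -> x = y.
  by rewrite !modn_small // => /val_inj.
have lamD x y : lam (x + y) = lam x + lam y %[mod p].
  have -> : x + y = (lam x + lam y)%:R by rewrite natrD !natr_Zp.
  by rewrite [in LHS]/lam val_Fp_nat // modn_mod.
apply: (@avoiding_cube_bound p p z (fun x => lam x^-1) lam lam A B U V r pp _ zP) => //.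
- by rewrite p_gt1 leqnn.
- by move=> x y _ _; apply: lamI.
- by move=> x y _ _; apply: lamI.
- move=> u v a b uU vV aA bB uv0; rewrite -lamD => /lamI uvab.
  have /negP := avoid u v uU vV; apply; apply/imset2P; exists a b => //.
    rewrite inE bB -addr_eq0 -uvab invr_eq0 //.
  by rewrite -uvab invrK.
move=> k /andP[k0 kM] vs vs0 /=.
have := @weil_add p pp (fun y => z ^+ (k * lam y)).
rewrite /= => H.
apply: le_trans (H _ _ _ _ vs vs0) _ => //.
- by rewrite muln0 expr0.
- move=> x y; rewrite -exprD -mulnDr ![(k * _)%N]mulnC !exprM; congr (_ ^+ _).
  by apply/eqP; rewrite (eq_prim_root_expr zP) lamD.
- exists 1; rewrite -[X in _ != X](expr0 z) (eq_prim_root_expr zP) mod0n.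
  have -> : lam 1 = 1%N by rewrite -[1]/(1%:R) /lam val_Fp_nat // modn_small.
  by rewrite muln1 modn_small // -lt0n.
- by move=> y; rewrite normrX z1 expr1n.
Qed.

(** The 2r-th power of the theorem, where the exponent of p becomes the integer 4r^2 + r + 1 = 2r
    (2r + 1/2 + 1/(2r)). The cases |H|^(2r) < p and p = 2 follow from |A||B| <= p^2. *)
Lemma avoiding_hilbert_cube_nat (p r : nat) (A B H : {set 'F_p}) (n := (r + r)%N) :
    (0 < r)%N -> prime p -> A != set0 -> B != set0 -> 0 \notin A -> 0 \notin B ->
    is_hilbert_cube H -> H :&: prod_set A B = set0 \/ H :&: inv_sum_set A B = set0 ->
  (#|H| ^ n * (#|A| * #|B|) ^ (r * n) <=
     (2 * (2 ^ n * moment_const r)) ^ n * p ^ (n.*2.+1 * r).+1)%N.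
Proof.
move=> r0 pp A0 B0 zA zB [d [a0 [a HE]]] avoid.
have p1 := prime_gt1 pp; have p0 := prime_gt0 pp; have cF := card_Fp pp.
have n0 : (0 < n)%N by rewrite addn_gt0 r0.
set D := (2 ^ n * moment_const r)%N.
have D0 : (0 < D)%N by rewrite muln_gt0 expn_gt0 /moment_const addn_gt0 orbT.
have ABp : ((#|A| * #|B|) ^ (r * n) <= p ^ (n.*2 * r))%N.
  rewrite (_ : n.*2 * r = 2 * (r * n))%N; last by rewrite -mul2n -mulnA [(n * r)%N]mulnC.
  rewrite [X in (_ <= X)%N]expnM leq_exp2r ?muln_gt0 ?r0 // -mulnn.
  by apply: leq_mul; rewrite -[X in (_ <= X)%N]cF max_card.
have small X : (X <= (2 * D) ^ n * p)%N ->
    (X * (#|A| * #|B|) ^ (r * n) <= (2 * D) ^ n * p ^ (n.*2.+1 * r).+1)%N.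
  move=> XD; apply: (leq_trans (leq_mul XD ABp)).
  rewrite -mulnA leq_mul2l -expnS leq_exp2l // ltnS leq_mul2r leqnSn ?orbT //.
have D2n : (1 <= (2 * D) ^ n)%N by rewrite expn_gt0 muln_gt0 D0.
have [pH|Hp] := leqP p (#|H| ^ n); last first.
  by apply: small; rewrite (leq_trans (ltnW Hp)) // leq_pmull.
have [p2|p2] := leqP p 2.
  apply: small; apply: (@leq_trans ((2 * D) ^ n)%N); last by rewrite leq_pmulr.
  rewrite leq_exp2r // (leq_trans (max_card _)) // cF (leq_trans p2) // leq_pmulr //.
rewrite HE in pH; have [U [V [HUV pV Vp]]] := hilbert_cube_split p1 pH.
rewrite -HE in HUV pH.
have HUVc : (#|H| <= #|U| * #|V|)%N.
  by rewrite HUV curry_imset2X (leq_trans (leq_imset_card _ _)) ?cardsX.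
have U0 : (0 < #|U|)%N.
  rewrite lt0n; apply: contraTneq pH => U0; rewrite -ltnNge.
  by move: HUVc; rewrite U0 mul0n leqn0 => /eqP->; rewrite exp0n.
have cA : (0 < #|A|)%N by rewrite card_gt0.
have cB : (0 < #|B|)%N by rewrite card_gt0.
have main : (#|U| ^ 2 * (#|A| * #|B|) ^ n <= D ^ 2 * p ^ n.*2.+1)%N.
  case: avoid => HAB.
    apply: (product_avoiding_bound pp p2 zA zB _ r0 pV U0 cA cB) => u v uU vV.
    apply/negP => uvAB; suff: u + v \in H :&: prod_set A B by rewrite HAB inE.
    by rewrite inE uvAB HUV imset2_f.
  apply: (inv_sum_avoiding_bound pp _ r0 pV U0 cA cB) => u v uU vV.
  apply/negP => uvAB; suff: u + v \in H :&: inv_sum_set A B by rewrite HAB inE.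
  by rewrite inE uvAB HUV imset2_f.
(* The r-th power of the bound produces |U|^(2r), ready to be multiplied by |V|^(2r) <= 2^(2r) p. *)
have {}main : (#|U| ^ n * (#|A| * #|B|) ^ (r * n) <= D ^ n * p ^ (n.*2.+1 * r))%N.
  move: main; rewrite -(leq_exp2r _ _ r0) [X in (X <= _)%N -> _]expnMn.
  rewrite [X in (_ <= X)%N -> _]expnMn -!expnM mul2n -addnn -/n.
  by rewrite [(n * r)%N]mulnC.
apply: (@leq_trans ((#|U| * #|V|) ^ n * (#|A| * #|B|) ^ (r * n))%N).
  by rewrite leq_mul2r leq_exp2r // HUVc orbT.
rewrite !expnMn mulnAC -!expnMn [((2 * D) ^ n)%N]expnMn.
apply: (leq_trans (leq_mul main Vp)); apply: eq_leq.
by rewrite expnS; ring.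
Qed.

Theorem theorem1p1 (R : realType) (r : nat) (hr : (0 < r)%N) :
  exists2 c : R, 0 < c &
    forall (p : nat) (hp : prime p) (A B H : {set 'F_p}),
      A != set0 -> B != set0 -> 0 \notin A -> 0 \notin B ->
      is_hilbert_cube H ->
      H :&: prod_set A B = set0 \/ H :&: inv_sum_set A B = set0 ->
      #|H|%:R <= c * (p%:R `^ (2 * r%:R + 1 / 2 + 1 / (2 * r%:R))
                      / (#|A|%:R * #|B|%:R) ^+ r).
Proof.
pose n := (r + r)%N; pose C := (2 * (2 ^ n * moment_const r))%N.
have C0 : (0 < C)%N by rewrite !muln_gt0 expn_gt0 /moment_const addn_gt0 orbT.
have n0 : (0 < n)%N by rewrite addn_gt0 hr.
exists C%:R => [|p pp A B H A0 B0 zA zB HH avoid]; first by rewrite ltr0n.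
have bound := avoiding_hilbert_cube_nat hr pp A0 B0 zA zB HH avoid.
have AB0 : (0 : R) < #|A|%:R * #|B|%:R by rewrite mulr_gt0 // ltr0n card_gt0.
set E := _ + _; have pE0 : 0 <= p%:R `^ E :> R by apply: powR_ge0.
rewrite mulrA ler_pdivlMr ?exprn_gt0 //.
rewrite -(ler_pXn2r n0) ?nnegrE ?mulr_ge0 ?exprn_ge0 ?(ltW AB0) //.
rewrite !exprMn -[X in _ <= _ * X]powR_mulrn // -powRrM.
have -> : E * n%:R = (n.*2.+1 * r).+1%:R.
  have r0 : (r%:R : R) != 0 by rewrite pnatr_eq0 -lt0n.
  rewrite /E /n -addnn -[(_ * r).+1]addn1 -[(_ + _).+1]addn1 !(natrD, natrM).
  by field.
rewrite powR_mulrn // -!exprM -exprMn -natrM -!natrX -!natrM ler_nat.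
exact: bound.
Qed.
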